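(* Let $(X,\varphi)$ and $(Y,\psi)$ be Cantor minimal systems. The following statements are equivalent: (1) there is a factor map from $(X,\varphi)$ to $(Y,\psi)$; (2) there are Bratteli–Vershik models $C$ and $B$ for $(X,\varphi)$ and $(Y,\psi)$, respectively, such that there is an ordered premorphism from $B$ to $C$.
   Context: A Cantor minimal system $(X,\varphi)$ is a minimal homeomorphism $\varphi$ of a space $X$ homeomorphic to the Cantor set. A factor map $(X,\varphi)\to(Y,\psi)$ is a continuous surjection $\alpha:X\to Y$ with $\alpha\circ\varphi=\psi\circ\alpha$; a conjugacy is a factor map that is a homeomorphism. **Bratteli diagrams.** A Bratteli diagram $(V,E)$ consists of a vertex set $V=V_0\sqcup V_1\sqcup\cdots$ with each $V_n$ finite and non-empty and $V_0$ a singleton, and an edge set $E=E_1\sqcup E_2\sqcup\cdots$ with each $E_n$ finite and non-empty, together with maps $r,s:E\to V$ (range, source) such that $r(E_n)\subseteq V_n$, $s(E_n)\subseteq V_{n-1}$, $s^{-1}\{v\}\neq\varnothing$ for all $v\in V$ and $r^{-1}\{v\}\ne\varnothing$ for all $v\in V\setminus V_0$. An ordered Bratteli diagram $(V,E,\geq)$ is a Bratteli diagram with a partial order on $E$ such that $e,e'$ are comparable iff $r(e)=r(e')$. It is properly ordered if there is exactly one infinite path $x_{\max}=(e_1,e_2,\ldots)$ ($e_i\in E_i$, $r(e_i)=s(e_{i+1})$) consisting of maximal edges, and exactly one, $x_{\min}$, consisting of minimal edges. For $B$ properly ordered, $X_B$ is the space of infinite paths, with the cylinder sets as a basis of the topology,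 and the Vershik homeomorphism $\lambda_B$ is given by $\lambda_B(x_{\max})=x_{\min}$ and, for other $x=(e_1,e_2,\ldots)$, with $k$ least such that $e_k$ is not maximal, $f_k$ the successor of $e_k$ in $r^{-1}\{r(e_k)\}$ and $(f_1,\ldots,f_{k-1})$ the path of minimal edges from $V_0$ to $s(f_k)$, by $\lambda_B(x)=(f_1,\ldots,f_k,e_{k+1},\ldots)$. A Bratteli–Vershik model for $(X,\varphi)$ is a properly ordered Bratteli diagram $B$ such that $(X_B,\lambda_B)$ is conjugate to $(X,\varphi)$. **Edge sets.** An ordered edge set from a finite set $S$ to a finite set $T$ is a finite set $F$ with maps $s:F\to S$, $r:F\to T$ and a linear order on each $r^{-1}\{w\}$, $w\in T$. If $G$ is an ordered edge set from $T$ to $U$, then $F\circ G=\{(e,g)\in F\times G: r(e)=s(g)\}$, with source $s(e)$, range $r(g)$, and order: for $r(g)=r(g')$, $(e,g)<(e',g')$ iff $g<g'$, or $g=g'$ and $e<e'$. Write $F\cong F'$ if there is a bijection $F\to F'$ preserving sources, ranges and order. For $k<l$, $E_{k,l}=E_{k+1}\circ\cdots\circ E_l$; $E_{k,k}$ consists of one edge from $v$ to $v$ for each $v\in V_k$. **Ordered premorphisms.** An ordered premorphism $f:B=(V,E,\ge)\to C=(W,S,\ge)$ is a triple $(F,(f_n)_{n\ge0},\geq)$ where $(f_n)$ is an unbounded sequence of integers with $0=f_0\le f_1\le\cdots$, and $F=F_0\sqcup F_1\sqcup\cdots$ where each $F_n$ is a non-empty finite ordered edge set from $V_n$ to $W_{f_n}$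 such that every $v\in V_n$ is the source and every $w\in W_{f_n}$ the range of some edge of $F_n$, $F_0$ is a singleton, and $E_{n+1}\circ F_{n+1}\cong F_n\circ S_{f_n,f_{n+1}}$ for all $n\ge0$. *)

(* Defs.v *)
From HB Require Import structures.
From mathcomp Require Import all_boot.
From mathcomp Require Import boolp classical_sets topology cantor.

Set Implicit Arguments.
Unset Strict Implicit.
Unset Printing Implicit Defensive.

Local Open Scope classical_set_scope.

Definition homeomorphism (X Y : topologicalType) (f : X -> Y) : Prop :=
  continuous f /\
  exists g : Y -> X, [/\ continuous g, cancel f g & cancel g f].

Definition minimal (X : topologicalType) (phi : X -> X) : Prop :=
  forall A : set X, closed A -> phi @` A = A -> A = set0 \/ A = setT.

Definition cantor_minimal_system (X : topologicalType) (phi : X -> X) : Prop :=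
  [/\ exists h : X -> cantor_space, homeomorphism h,
      homeomorphism phi & minimal phi].

Definition factor_map (X Y : topologicalType) (phi : X -> X) (psi : Y -> Y)
    (alpha : X -> Y) : Prop :=
  [/\ continuous alpha, range alpha = setT &
      forall x, alpha (phi x) = psi (alpha x)].

Definition conjugacy (X Y : topologicalType) (phi : X -> X) (psi : Y -> Y)
    (alpha : X -> Y) : Prop :=
  factor_map phi psi alpha /\ homeomorphism alpha.

Definition conjugate (X Y : topologicalType) (phi : X -> X) (psi : Y -> Y) :
    Prop :=
  exists alpha, conjugacy phi psi alpha.

(* The linear orders on the fibres of the range map are given together, as one
   partial order for which comparability means having the same range. *)
Record edgeset (S T : finType) := EdgeSet {
  edge :> finType;
  src : edge -> S;
  rng : edge -> T;
  ele : rel edge;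
  ele_refl : reflexive ele;
  ele_anti : antisymmetric ele;
  ele_trans : transitive ele;
  ele_comparable : forall e e', (ele e e' || ele e' e) = (rng e == rng e')
}.

Section EdgeSets.
Variables S T : finType.

Section Order.
Variable F : edgeset S T.
Implicit Types e : F.

Definition elt : rel F := fun e e' => ele e e' && (e != e').

Definition emax e : Prop := forall e', ele e e' -> e' = e.

Definition emin e : Prop := forall e', ele e' e -> e' = e.

Definition esucc e e' : Prop :=
  elt e e' /\ forall e'', elt e e'' -> ele e' e''.

Lemma ele_rng e e' : ele e e' -> rng e = rng e'.
Proof. by move=> h; apply/eqP; rewrite -ele_comparable h. Qed.

Lemma emin_exists (e0 : F) : exists2 e : F, emin e & rng e = rng e0.
Proof.
pose h (e : F) := #|[pred e' | ele e' e]|.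
case: (@arg_minnP F e0 (fun e => rng e == rng e0) h (eqxx _)).
move=> e /eqP re hmin; exists e => // e' le'.
apply/eqP/negP => /negP ne.
have /hmin : rng e' == rng e0 by rewrite -re (ele_rng le').
apply/negP; rewrite -ltnNge; apply: proper_card; apply/fintype.properP; split.
  by apply/fintype.subsetP => f; rewrite !inE => /ele_trans; apply.
exists e; rewrite !inE ?ele_refl //; apply/negP => l.
by case/negP: ne; apply/eqP; apply: (@ele_anti _ _ F); rewrite le' l.
Qed.

Lemma emin_uniq e e' : emin e -> emin e' -> rng e = rng e' -> e = e'.
Proof.
move=> m m' /eqP; rewrite -ele_comparable => /orP[/m'|/m] //.
Qed.

Lemma esucc_exists e : ~ emax e -> exists e', esucc e e'.
Proof.
move=> nm; have [e0 l0] : exists e0, elt e e0.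
  apply: contrapT => h; apply: nm => e' l; apply/eqP/negP => /negP n.
  by apply: h; exists e'; rewrite /elt l eq_sym n.
pose h (f : F) := #|[pred e' | ele e' f]|.
case: (@arg_minnP F e0 (elt e) h l0) => f lf hmin; exists f; split=> // g lg.
have : ele f g || ele g f.
  case/andP: lf => /ele_rng rf _; case/andP: lg => /ele_rng rg _.
  by rewrite ele_comparable -rf -rg.
case/orP=> // gf.
have /hmin := lg; rewrite leqNgt => /negP hn.
apply: contrapT => nfg; apply: hn; apply: proper_card; apply/fintype.properP; split.
  by apply/fintype.subsetP => k; rewrite !inE => /ele_trans; apply.
by exists f; rewrite !inE ?ele_refl //; apply/negP.
Qed.

Lemma esucc_uniq e f g : esucc e f -> esucc e g -> f = g.
Proof.
move=> [l1 h1] [l2 h2]; apply: (@ele_anti _ _ F).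
by rewrite h1 // h2.
Qed.

End Order.

Definition edgeset_iso (F F' : edgeset S T) : Prop :=
  exists theta : F -> F',
    [/\ bijective theta,
        forall e, src (theta e) = src e,
        forall e, rng (theta e) = rng e &
        forall e e', ele (theta e) (theta e') = ele e e'].

End EdgeSets.

Section Identity.
Variable S : finType.

Fact id_ele_anti : antisymmetric (fun v w : S => v == w).
Proof. by move=> v w /andP[/eqP]. Qed.

Fact id_ele_trans : transitive (fun v w : S => v == w).
Proof. by move=> v u w /eqP-> /eqP->. Qed.

Fact id_ele_comparable (v w : S) : (v == w) || (w == v) = (v == w).
Proof. by rewrite (eq_sym w) orbb. Qed.

Definition edgeset_id : edgeset S S :=
  @EdgeSet S S S id id (fun v w => v == w)
    (@eqxx S) id_ele_anti id_ele_trans id_ele_comparable.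

End Identity.

Section Composition.
Variables (S T U : finType) (F : edgeset S T) (G : edgeset T U).

Definition comp_edge : finType := {p : F * G | rng p.1 == src p.2}.

Definition comp_ele : rel comp_edge := fun p q =>
  elt (val p).2 (val q).2 ||
  ((val p).2 == (val q).2) && ele (val p).1 (val q).1.

Fact comp_ele_refl : reflexive comp_ele.
Proof. by move=> p; rewrite /comp_ele eqxx ele_refl orbT. Qed.

Fact comp_ele_anti : antisymmetric comp_ele.
Proof.
move=> [[e g] /= eg] [[e' g'] /= eg'] H; apply/val_inj => /=.
move: H; rewrite /comp_ele /= /elt (eq_sym g').
case: (g =P g') => [->|ng] /=.
  by rewrite !andbF /= => /ele_anti ->.
by rewrite !andbT !orbF => /ele_anti.
Qed.

Fact comp_ele_trans : transitive comp_ele.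
Proof.
move=> [[e2 g2] /= eg2] [[e1 g1] /= eg1] [[e3 g3] /= eg3].
rewrite /comp_ele /= /elt.
case/orP=> [/andP[l12 n12]|/andP[/eqP E1 l12]];
  case/orP=> [/andP[l23 n23]|/andP[/eqP E2 l23]].
- rewrite (ele_trans l12 l23) /=; have [E|//] := eqVneq g1 g3.
  by move: n12; rewrite (@ele_anti _ _ G g1 g2) ?eqxx // l12 E l23.
- by rewrite -E2 l12 n12.
- by rewrite E1 l23 n23.
- by rewrite E1 E2 eqxx (ele_trans l12 l23) orbT.
Qed.

Fact comp_ele_comparable (p q : comp_edge) :
  (comp_ele p q || comp_ele q p) = (rng (val p).2 == rng (val q).2).
Proof.
case: p q => [[e g] /= heg] [[e' g'] /= heg'].
have /eqP eg := heg; have /eqP eg' := heg'.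
rewrite /comp_ele /= /elt.
case: (g =P g') => [gg|/eqP/negbTE ng].
  by rewrite -gg !eqxx !andbF /= ele_comparable eg eg' gg eqxx.
by rewrite (eq_sym g') ng !andbT !orbF ele_comparable.
Qed.

Definition edgeset_comp : edgeset S U :=
  @EdgeSet S U comp_edge (fun p => src (val p).1) (fun p => rng (val p).2)
    comp_ele comp_ele_refl comp_ele_anti comp_ele_trans comp_ele_comparable.

End Composition.

(* [bedges n] goes from level [n] to level [n.+1]: it is E_(n+1) in the usual
   numbering. *)
Record bratteli := Bratteli {
  bvert : nat -> finType;
  bedges : forall n, edgeset (bvert n) (bvert n.+1);
  bvert_gt0 : forall n, 0 < #|bvert n|;
  bvert0 : #|bvert 0| = 1;
  bedges_gt0 : forall n, 0 < #|bedges n|;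
  bsrc_surj : forall n (v : bvert n), exists e : bedges n, src e = v;
  brng_surj : forall n (v : bvert n.+1), exists e : bedges n, rng e = v
}.

(* E_(k, m + k), bracketed to the left and starting with the identity edge set
   E_(k, k). *)
Fixpoint btele (B : bratteli) (k m : nat) :
    edgeset (bvert B k) (bvert B (m + k)) :=
  if m is m'.+1 then edgeset_comp (btele B k m') (bedges B (m' + k))
  else edgeset_id (bvert B k).

Definition bsegment (B : bratteli) (k l : nat) (kl : k <= l) :
    edgeset (bvert B k) (bvert B l) :=
  ecast n (edgeset (bvert B k) (bvert B n)) (subnK kl) (btele B k (l - k)).

Record bpath (B : bratteli) := BPath {
  pedge :> forall n, bedges B n;
  pedge_chain : forall n, rng (pedge n) = src (pedge n.+1)
}.

HB.instance Definition _ (B : bratteli) := gen_eqMixin (bpath B).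
HB.instance Definition _ (B : bratteli) := gen_choiceMixin (bpath B).

Section PathSpace.
Variable B : bratteli.
Implicit Types x y : bpath B.

Definition cylinder x n : set (bpath B) :=
  [set y | forall i, i < n -> y i = x i].

(* Every finite path from the top vertex extends to an infinite one, so that
   cylinders can be indexed by infinite paths. *)
Definition cylinders : set (set (bpath B)) :=
  [set U | exists x n, U = cylinder x n].

Fact cylinders_cover : \bigcup_(U in cylinders) U = setT.
Proof.
by apply/seteqP; split=> // x _; exists (cylinder x 0) => //; exists x, 0.
Qed.

Fact cylinders_join (U W : set (bpath B)) x :
  cylinders U -> cylinders W -> U x -> W x ->
  exists Z, [/\ cylinders Z, Z x & Z `<=` U `&` W].
Proof.
move=> [y [n ->]] [z [m ->]] /= xy xz.
exists (cylinder x (maxn n m)); split; first by exists x, (maxn n m).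
  by [].
move=> t /= tx; split=> i hi.
  by rewrite tx ?xy // (leq_trans hi) ?leq_maxl.
by rewrite tx ?xz // (leq_trans hi) ?leq_maxr.
Qed.

End PathSpace.

HB.instance Definition _ (B : bratteli) :=
  @isBaseTopological.Build (bpath B) (set (bpath B)) (@cylinders B) id
    (@cylinders_cover B) (@cylinders_join B).

Section Vershik.
Variable B : bratteli.
Implicit Types x y : bpath B.

Definition max_path x : Prop := forall n, emax (x n).

Definition min_path x : Prop := forall n, emin (x n).

Definition properly_ordered : Prop :=
  (exists! x, max_path x) /\ (exists! x, min_path x).

Definition vershik_step x y : Prop :=
  (max_path x /\ min_path y) \/
  exists k,
    [/\ forall i, i < k -> emax (x i),
        ~ emax (x k),
        esucc (x k) (y k),
        forall i, i < k -> emin (y i) &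
        forall i, k < i -> y i = x i].

(* Meaningful for properly ordered diagrams only, see [vershikP] below. *)
Definition vershik x : bpath B := xget x (vershik_step x).

Lemma bpath_eq x y : (forall i, x i = y i) -> x = y.
Proof.
case: x y => [x hx] [y hy] /= xy.
have E : x = y by apply: functional_extensionality_dep.
by case: y / E hy {xy} => hy; congr BPath; apply: Prop_irrelevance.
Qed.

Lemma emin_prefix (k : nat) (x : forall n, bedges B n) :
  exists y : forall n, bedges B n,
    (forall i, k <= i -> y i = x i) /\
    (forall i, i < k -> emin (y i) /\ rng (y i) = src (y i.+1)).
Proof.
elim: k x => [|k IHk] x; first by exists x.
have [e0 re0] := brng_surj (src (x k.+1)).
have [e me re] := emin_exists e0.
have [y [ytail yhead]] := IHk (dfwith x e).
have yk : y k = e by rewrite ytail // dfwith_in.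
have yx i : k < i -> y i = x i.
  by move=> ki; rewrite ytail ?(ltnW ki) // dfwith_out ?ltn_eqF.
exists y; split=> // i; rewrite ltnS leq_eqVlt => /predU1P[->|/yhead //].
by rewrite yk yx // re re0.
Qed.

Lemma vershik_step_exists x : properly_ordered -> exists y, vershik_step x y.
Proof.
move=> [_ [xmin [hmin _]]].
have [hx|hx] := pselect (max_path x); first by exists xmin; left.
have ex : exists k, `[< ~ emax (x k) >].
  by apply: contrapT => h; apply: hx => n; apply: contrapT => hn;
    apply: h; exists n; apply/asboolP.
case: (ex_minnP ex) => k /asboolP hk kmin.
have [f hf] := esucc_exists hk.
have [y [ytail yhead]] := emin_prefix k (dfwith x f).
have yk : y k = f by rewrite ytail // dfwith_in.
have yx i : k < i -> y i = x i.
  by move=> ki; rewrite ytail ?(ltnW ki) // dfwith_out ?ltn_eqF.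
have ychain n : rng (y n) = src (y n.+1).
  case: (ltngtP n k) => [/yhead[]//|kn|->].
    by rewrite !yx ?pedge_chain // ltnW.
  by rewrite yk yx // -pedge_chain; case: hf => /andP[/ele_rng->].
exists (BPath ychain); right; exists k; split=> //=.
- move=> i ik; apply: contrapT => /asboolP/kmin.
  by rewrite leqNgt ik.
- by rewrite yk.
- by move=> i /yhead[].
Qed.

Lemma vershik_step_uniq x y z :
  properly_ordered -> vershik_step x y -> vershik_step x z -> y = z.
Proof.
move=> [_ [xmin [_ minU]]].
case=> [[mx my]|[k [bk nk sk mk tk]]];
  case=> [[mx' mz]|[l [bl nl sl ml tl]]].
- by rewrite -(minU _ my) -(minU _ mz).
- by case: nl.
- by case: nk.
have E : k = l by case: (ltngtP k l) => // [/bl|/bk].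
move: E bl nl sl ml tl => <- {l} _ _ sl ml tl.
apply: bpath_eq => i; case: (ltngtP i k) => [ik|ki|->]; last 2 first.
- by rewrite tk ?tl.
- exact: esucc_uniq sk sl.
have down d : d < k -> y (k - d.+1) = z (k - d.+1).
  elim: d => [|d IHd] dk.
    apply: emin_uniq (mk _ _) (ml _ _) _; rewrite ?ltn_subrL ?dk //.
    rewrite !pedge_chain subn1 prednK //.
    by rewrite (esucc_uniq sk sl).
  apply: emin_uniq (mk _ _) (ml _ _) _; rewrite ?ltn_subrL ?(leq_ltn_trans _ dk) //.
  by rewrite !pedge_chain subnSK // IHd // ltnW.
have := down (k - i.+1); rewrite subnSK // (subKn (ltnW ik)); apply.
exact: leq_subr.
Qed.

Lemma vershikP x y : properly_ordered -> vershik_step x y <-> y = vershik x.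
Proof.
move=> PB; have /(xgetPex x) hv := vershik_step_exists x PB; split=> [h|->//].
exact: vershik_step_uniq h hv.
Qed.

End Vershik.

Definition bratteli_vershik_model (B : bratteli) (X : topologicalType)
    (phi : X -> X) : Prop :=
  properly_ordered B /\ conjugate (@vershik B) phi.

Record premorphism (B C : bratteli) := Premorphism {
  pm_level : nat -> nat;
  pm_edges : forall n, edgeset (bvert B n) (bvert C (pm_level n));
  pm_level0 : pm_level 0 = 0;
  pm_levelS : forall n, pm_level n <= pm_level n.+1;
  pm_unbounded : forall N, exists n, N <= pm_level n;
  pm_edges_gt0 : forall n, 0 < #|pm_edges n|;
  pm_src_surj : forall n (v : bvert B n), exists e : pm_edges n, src e = v;
  pm_rng_surj : forall n (w : bvert C (pm_level n)),
    exists e : pm_edges n, rng e = w;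
  pm_edges0 : #|pm_edges 0| = 1;
  pm_comm : forall n,
    edgeset_iso
      (edgeset_comp (bedges B n) (pm_edges n.+1))
      (edgeset_comp (pm_edges n) (bsegment C (pm_levelS n)))
}.

(* Main.v *)
Require Import Defs.
From mathcomp Require Import all_boot.
From mathcomp Require Import boolp classical_sets topology cantor.
From mathcomp Require Import mathcomp_extra.
From mathcomp Require Import zify.

(** From a premorphism to a factor map. Let [F] be a premorphism from [B] to [C],
    with levels [f]. Read a path [x] of [C] one segment at a time: starting with
    the only edge [g_0] of [F_0], the pair made of [g_n] and of the segment of
    [x] between levels [f_n] and [f_(n+1)] corresponds, by the commutation
    isomorphism, to a pair made of an edge [e_n] of [B] and an edge [g_(n+1)] of
    [F_(n+1)]. The edges [e_n] form a path of [B], which depends continuously on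
    [x] ([pm_map_continuous]). Since maximal edges, minimal edges and successors
    in a composition of ordered edge sets are determined by those of the two
    factors, and are preserved by isomorphisms, this map commutes with the
    Vershik maps ([pm_map_step]). It is onto because the image of a compact
    system in a minimal one is everything ([factor_map_onto]).

    From a factor map to a premorphism. A Kakutani-Rokhlin structure [kr] cuts a
    minimal system into finitely many clopen towers; over any nonempty clopen
    set there is one whose levels are as fine as desired, built from the return
    times to that set ([kr_exists]). If [alpha] is an equivariant map, [P] a
    structure on the target and [Q] a structure on the source which is finer
    than the pull-back of [P], then each tower of [Q] is a concatenation of
    passages through towers of [P]; these passages form an ordered edge set
    [kedges alpha P Q], and they compose ([kedges_comp]):

      kedges alpha P Q \o kedges beta Q R  =~  kedges (alpha \o beta) P R.

    A refining sequence of structures whose bases shrink to a point and whose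
    levels separate points gives a Bratteli diagram, with the passages for the
    identity map as edges, and sending a point to its itinerary is a conjugacy
    onto the path space with its Vershik map ([ks_model]). Given
    a factor map [alpha] from [X] to [Y], such a sequence [P_n] is first chosen
    for [Y], then one [Q_n] for [X] with [Q_n] finer than the pull-back of
    [P_n]. The edge sets [kedges alpha P_n Q_n] form a premorphism: in the
    commutation condition both sides are isomorphic to [kedges alpha P_n
    Q_(n+1)] ([factor_comm]). *)

Set Implicit Arguments.
Unset Strict Implicit.
Unset Printing Implicit Defensive.

Local Open Scope classical_set_scope.

(** * Ordered edge sets *)

Lemma inj_surj_bijective (A B : Type) (f : A -> B) :
  injective f -> (forall b, exists a, f a = b) -> bijective f.
Proof.
move=> fI fS; exists (fun b => sval (cid (fS b))) => [a|b].
  by apply: fI; case: cid.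
by case: cid.
Qed.

Section EdgesetIso.
Variables S T : finType.

Lemma edgeset_iso_sym (F F' : edgeset S T) :
  edgeset_iso F F' -> edgeset_iso F' F.
Proof.
move=> [f [[g fK gK] fs fr fo]]; exists g; split; first by exists f.
- by move=> e; rewrite -fs gK.
- by move=> e; rewrite -fr gK.
- by move=> e e'; rewrite -fo !gK.
Qed.

Lemma edgeset_iso_trans (F F' F'' : edgeset S T) :
  edgeset_iso F F' -> edgeset_iso F' F'' -> edgeset_iso F F''.
Proof.
move=> [f [fb fs fr fo]] [g [gb gs gr go]]; exists (g \o f); split.
- exact: bij_comp.
- by move=> e; rewrite /= gs.
- by move=> e; rewrite /= gr.
- by move=> e e'; rewrite /= go.
Qed.

(** A map preserving ranges and strictly increasing on each fibre of the range
    map also reflects the order, fibres being linearly ordered. *)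
Lemma edgeset_iso_of_mono (F F' : edgeset S T) (f : F -> F') :
  (forall e', exists e, f e = e') ->
  (forall e, src (f e) = src e) -> (forall e, rng (f e) = rng e) ->
  (forall e1 e2, elt e1 e2 -> elt (f e1) (f e2)) ->
  edgeset_iso F F'.
Proof.
move=> fS fs fr fm.
have cmp e1 e2 : rng e1 = rng e2 -> [\/ e1 = e2, elt e1 e2 | elt e2 e1].
  move=> /eqP; rewrite -ele_comparable.
  have [->|n] := eqVneq e1 e2; first by constructor 1.
  by case/orP=> l; [constructor 2|constructor 3]; rewrite /elt l //= eq_sym.
have fI : injective f.
  move=> e1 e2 e12; have : rng e1 = rng e2 by rewrite -!fr e12.
  by case/cmp=> // /fm; rewrite e12 /elt eqxx andbF.
exists f; split=> //; first exact: inj_surj_bijective.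
move=> e1 e2; apply/idP/idP => l.
- have : rng e1 = rng e2 by rewrite -!fr (ele_rng l).
  case/cmp=> [->|/andP[]//|/fm /andP[l' /eqP[]]]; first exact: ele_refl.
  by apply: (@ele_anti _ _ F'); rewrite l l'.
- have [->|n] := eqVneq e1 e2; first exact: ele_refl.
  by have /fm /andP[] : elt e1 e2 by rewrite /elt l n.
Qed.

Section Transport.
Variables (F F' : edgeset S T) (f : F -> F').
Hypothesis fb : bijective f.
Hypothesis fo : forall e e', ele (f e) (f e') = ele e e'.

Lemma iso_emax e : emax e -> emax (f e).
Proof.
by case: fb => g fK gK m e'; rewrite -(gK e') fo => /m ->.
Qed.

Lemma iso_emin e : emin e -> emin (f e).
Proof.
by case: fb => g fK gK m e'; rewrite -(gK e') fo => /m ->.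
Qed.

Lemma iso_elt e e' : elt (f e) (f e') = elt e e'.
Proof. by rewrite /elt fo bij_eq. Qed.

Lemma iso_esucc e e' : esucc e e' -> esucc (f e) (f e').
Proof.
case: (fb) => g fK gK [l m]; split; first by rewrite iso_elt.
by move=> e''; rewrite -(gK e'') iso_elt fo; apply: m.
Qed.

End Transport.
End EdgesetIso.

Section CompositionOrder.
Variables (S T U : finType) (F : edgeset S T) (G : edgeset T U).
Implicit Types (e : F) (g : G) (p q : edgeset_comp F G).

Lemma comp_eq p q : (val p).1 = (val q).1 -> (val p).2 = (val q).2 -> p = q.
Proof.
case: p q => [[e g] eg] [[e' g'] eg'] /= E1 E2.
by apply/val_inj; rewrite /= E1 E2.
Qed.

Lemma comp_chain p : rng (val p).1 = src (val p).2.
Proof. by case: p => [[e g] /= /eqP]. Qed.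

(** The pair of two consecutive edges, as an edge of the composition. *)
Definition comp_mk e g (h : rng e = src g) : edgeset_comp F G :=
  exist (fun p : F * G => rng p.1 == src p.2) (e, g) (introT eqP h).

Lemma comp_eltE p q : elt p q =
  elt (val p).2 (val q).2 ||
  ((val p).2 == (val q).2) && elt (val p).1 (val q).1.
Proof.
rewrite {1}/elt /= /comp_ele -val_eqE.
case: p q => [[e g] eg] [[e' g'] eg'] /=; rewrite /elt xpair_eqE.
case: (g =P g') => [->|/eqP n]; rewrite ?eqxx ?(negbTE n) /=.
  by rewrite !andbF !andbT.
by rewrite !andbF !andbT !orbF.
Qed.

Lemma comp_emax p : emax (val p).1 -> emax (val p).2 -> emax p.
Proof.
move=> m1 m2 q /orP[/andP[/m2-> /eqP//]|/andP[/eqP E /m1 E1]].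
exact: comp_eq.
Qed.

Lemma comp_emin p : emin (val p).1 -> emin (val p).2 -> emin p.
Proof.
move=> m1 m2 q /orP[/andP[/m2-> /eqP//]|/andP[/eqP E /m1 E1]].
exact: comp_eq.
Qed.

(** In the order of the composition the second edge counts first. So the
    successor of a pair is obtained either by moving the first edge only, or by
    moving the second edge and going from a maximal first edge to a minimal
    one. *)
Lemma comp_esucc1 p q :
  (val p).2 = (val q).2 -> esucc (val p).1 (val q).1 -> esucc p q.
Proof.
move=> E [l m]; split; first by rewrite comp_eltE E eqxx l orbT.
move=> t; rewrite comp_eltE E => /orP[h|/andP[/eqP h1 /m h2]].
  by apply/orP; left.
by apply/orP; right; rewrite h1 eqxx h2.
Qed.

Lemma comp_esucc2 p q : emax (val p).1 -> emin (val q).1 ->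
  esucc (val p).2 (val q).2 -> esucc p q.
Proof.
move=> m1 m2 [l m]; split; first by rewrite comp_eltE l.
move=> t; rewrite comp_eltE => /orP[/m h|/andP[_ /andP[/m1 ->]]]; last first.
  by rewrite eqxx.
rewrite /= /comp_ele /elt h /=.
case: ((val q).2 =P (val t).2) => //= E.
have /eqP : rng (val q).1 = rng (val t).1 by rewrite !comp_chain E.
by rewrite -ele_comparable => /orP[//|/m2 ->]; rewrite ele_refl.
Qed.

(* The converses need that the range map of the first factor is onto, so that
    an edge of the second factor can always be completed to a pair. *)
Hypothesis rngF : forall v, exists e, rng e = v.

Lemma emax_comp p : emax p -> emax (val p).1 /\ emax (val p).2.
Proof.
move=> m; split=> [e l|g l].
  have h : rng e = src (val p).2 by rewrite -comp_chain (ele_rng l).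
  have /m <- // : ele p (comp_mk h).
  by rewrite /= /comp_ele /= eqxx l orbT.
apply/eqP/negP => /negP n; have [e he] := rngF (src g).
have /m E : ele p (comp_mk he) by rewrite /= /comp_ele /= /elt l eq_sym n.
by move: n; rewrite -E eqxx.
Qed.

Lemma emin_comp p : emin p -> emin (val p).1 /\ emin (val p).2.
Proof.
move=> m; split=> [e l|g l].
  have h : rng e = src (val p).2 by rewrite -comp_chain (ele_rng l).
  have /m <- // : ele (comp_mk h) p.
  by rewrite /= /comp_ele /= eqxx l orbT.
apply/eqP/negP => /negP n; have [e he] := rngF (src g).
have /m E : ele (comp_mk he) p by rewrite /= /comp_ele /= /elt l n.
by move: n; rewrite -E eqxx.
Qed.

Lemma esucc_comp p q : esucc p q ->
  ((val p).2 = (val q).2 /\ esucc (val p).1 (val q).1) \/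
  [/\ emax (val p).1, emin (val q).1 & esucc (val p).2 (val q).2].
Proof.
move=> [l m]; move: (l); rewrite comp_eltE => /orP[l2|/andP[/eqP E l1]]; last first.
  left; split=> //; split=> // e le.
  have h : rng e = src (val q).2.
    by rewrite -E -comp_chain; case/andP: le => /ele_rng.
  have /m : elt p (comp_mk h) by rewrite comp_eltE /= E eqxx le orbT.
  by rewrite /= /comp_ele /= {1}/elt eqxx andbF.
have nle : ~~ ele (val q).2 (val p).2.
  apply/negP => l'; case/andP: l2 => l2 /eqP; apply.
  by apply: (@ele_anti _ _ G); rewrite l2 l'.
right; split.
- move=> e le; apply/eqP/negP => /negP n.
  have h : rng e = src (val p).2 by rewrite -comp_chain (ele_rng le).
  have /m : elt p (comp_mk h).
    by rewrite comp_eltE /= eqxx /elt le eq_sym n orbT.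
  rewrite /= /comp_ele /= /elt (negbTE nle) /= => /andP[/eqP E _].
  by rewrite E ele_refl in nle.
- move=> e le.
  have h : rng e = src (val q).2 by rewrite -comp_chain (ele_rng le).
  have /m : elt p (comp_mk h) by rewrite comp_eltE /= l2.
  rewrite /= /comp_ele /= {1}/elt eqxx andbF /= => l'.
  by apply: (@ele_anti _ _ F); rewrite le l'.
- split=> // g lg; have [e he] := rngF (src g).
  have /m : elt p (comp_mk he) by rewrite comp_eltE /= lg.
  rewrite /= /comp_ele /= => /orP[/andP[]//|/andP[/eqP-> _]].
  exact: ele_refl.
Qed.

End CompositionOrder.

(** * Restricting infinite paths to finite segments *)

Section Restriction.
Variable B : bratteli.
Implicit Types x y : bpath B.

Lemma bvert0_eq n (v w : bvert B n) : n = 0 -> v = w.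
Proof.
move=> n0; subst n; have /eqP/fintype1P [u hu] := bvert0 B.
by rewrite (hu v) (hu w).
Qed.

(** The segment of [x] from level [k] to level [m + k], together with the fact
    that it ends where [x] goes on. *)
Fixpoint tele_rest_sig x k m :
    {p : btele B k m | rng p = src (x (m + k))} :=
  match m with
  | 0 => exist (fun p : btele B k 0 => rng p = src (x k)) (src (x k)) erefl
  | m'.+1 =>
    let: exist p hp := tele_rest_sig x k m' in
    exist (fun p : btele B k m'.+1 => rng p = src (x (m'.+1 + k)))
      (comp_mk hp) (pedge_chain x (m' + k))
  end.

Definition tele_rest x k m : btele B k m := sval (tele_rest_sig x k m).

Lemma tele_restS1 x k m : (val (tele_rest x k m.+1)).1 = tele_rest x k m.
Proof. by rewrite /tele_rest /=; case: tele_rest_sig. Qed.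

Lemma tele_restS2 x k m : (val (tele_rest x k m.+1)).2 = x (m + k).
Proof. by rewrite /tele_rest /=; case: tele_rest_sig. Qed.

Lemma tele_rest_rng x k m : rng (tele_rest x k m) = src (x (m + k)).
Proof. exact: svalP (tele_rest_sig x k m). Qed.

Lemma tele_rest_src x k m : src (tele_rest x k m) = src (x k).
Proof. by elim: m => //= m IHm; rewrite tele_restS1. Qed.

Lemma tele_rest_eq x y k m :
  (forall i, k <= i <= m + k -> x i = y i) -> tele_rest x k m = tele_rest y k m.
Proof.
elim: m => [|m IHm] xy; first by rewrite /tele_rest /= xy ?leqnn.
apply: comp_eq; rewrite ?tele_restS1 ?tele_restS2.
  by apply: IHm => i hi; apply: xy; lia.
by apply: xy; lia.
Qed.

Lemma tele_rest_emax x k m :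
  (forall i, k <= i < m + k -> emax (x i)) -> emax (tele_rest x k m).
Proof.
elim: m => [|m IHm] xm; first by move=> e /eqP ->.
apply: comp_emax; rewrite ?tele_restS1 ?tele_restS2.
  by apply: IHm => i hi; apply: xm; lia.
by apply: xm; lia.
Qed.

Lemma tele_rest_emin x k m :
  (forall i, k <= i < m + k -> emin (x i)) -> emin (tele_rest x k m).
Proof.
elim: m => [|m IHm] xm; first by move=> e /eqP ->.
apply: comp_emin; rewrite ?tele_restS1 ?tele_restS2.
  by apply: IHm => i hi; apply: xm; lia.
by apply: xm; lia.
Qed.

Lemma tele_rest_esucc x y k m j : k <= j < m + k ->
  (forall i, i < j -> emax (x i)) -> (forall i, i < j -> emin (y i)) ->
  esucc (x j) (y j) -> (forall i, j < i -> y i = x i) ->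
  esucc (tele_rest x k m) (tele_rest y k m).
Proof.
move=> + xm ym xy yx; elim: m => [|m IHm] hj; first lia.
have [jm|jm] : j = m + k \/ j < m + k by lia.
  subst j.
  apply: comp_esucc2; rewrite ?tele_restS1 ?tele_restS2.
  - by apply: tele_rest_emax => i hi; apply: xm; lia.
  - by apply: tele_rest_emin => i hi; apply: ym; lia.
  - exact: xy.
apply: comp_esucc1; rewrite ?tele_restS1 ?tele_restS2.
  by rewrite yx.
by apply: IHm; lia.
Qed.

Section Segment.
Variables (k l : nat) (kl : k <= l).

(** The segment of [x] from level [k] to level [l]. *)
Definition seg_rest x : bsegment B kl :=
  match subnK kl as E in _ = n return
    ecast n (edgeset (bvert B k) (bvert B n)) E (btele B k (l - k))
  with erefl => tele_rest x k (l - k) end.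

(* Statements on segments follow from those on [btele] by destructing the
   equation [l - k + k = l], once [l - k] is replaced by a variable. *)
Lemma seg_rest_rng x : rng (seg_rest x) = src (x l).
Proof.
rewrite /seg_rest /bsegment; move: (subnK kl); move: (l - k) => m E.
case: l / E kl => _; exact: tele_rest_rng.
Qed.

Lemma seg_rest_src x : src (seg_rest x) = src (x k).
Proof.
rewrite /seg_rest /bsegment; move: (subnK kl); move: (l - k) => m E.
case: l / E kl => _; exact: tele_rest_src.
Qed.

Lemma seg_rest_eq x y :
  (forall i, k <= i <= l -> x i = y i) -> seg_rest x = seg_rest y.
Proof.
rewrite /seg_rest /bsegment; move: (subnK kl); move: (l - k) => m E.
case: l / E kl => _; exact: tele_rest_eq.
Qed.

Lemma seg_rest_emax x :
  (forall i, k <= i < l -> emax (x i)) -> emax (seg_rest x).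
Proof.
rewrite /seg_rest /bsegment; move: (subnK kl); move: (l - k) => m E.
case: l / E kl => _; exact: tele_rest_emax.
Qed.

Lemma seg_rest_emin x :
  (forall i, k <= i < l -> emin (x i)) -> emin (seg_rest x).
Proof.
rewrite /seg_rest /bsegment; move: (subnK kl); move: (l - k) => m E.
case: l / E kl => _; exact: tele_rest_emin.
Qed.

Lemma seg_rest_esucc x y j : k <= j < l ->
  (forall i, i < j -> emax (x i)) -> (forall i, i < j -> emin (y i)) ->
  esucc (x j) (y j) -> (forall i, j < i -> y i = x i) ->
  esucc (seg_rest x) (seg_rest y).
Proof.
rewrite /seg_rest /bsegment; move: (subnK kl); move: (l - k) => m E.
case: l / E kl => _; exact: tele_rest_esucc.
Qed.

End Segment.

(** Over one level, the composed edge set is the edge set itself. *)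
Lemma bsegment_iso n (h : n <= n.+1) :
  edgeset_iso (bedges B n) (bsegment B h).
Proof.
rewrite /bsegment; move: (subnK h); move Em : (n.+1 - n) => m E.
have m1 : m = 1 by lia.
move: m1 E {Em} => -> E; rewrite (eq_irrelevance E erefl) /=.
apply: edgeset_iso_sym.
exists (fun p : edgeset_comp (edgeset_id (bvert B n)) (bedges B n) =>
  (val p).2); split=> [|p|p|p q] //.
- apply: inj_surj_bijective => [p q pq|e].
    have sp := comp_chain p; have sq := comp_chain q.
    by apply: comp_eq => //; rewrite [LHS]sp [RHS]sq pq.
  have he : rng (src e : edgeset_id (bvert B n)) = src e by [].
  by exists (comp_mk he).
- by rewrite -comp_chain.
- have sp := comp_chain p; have sq := comp_chain q.
  rewrite /= /comp_ele /elt /=.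
  case: eqP => [E'|_]; last by rewrite andbT orbF.
  rewrite andbF /= E' ele_refl; apply/esym/eqP.
  by rewrite [LHS]sp [RHS]sq E'.
Qed.

End Restriction.

Lemma iso_comp_r (S T U : finType) (F : edgeset S T) (G G' : edgeset T U) :
  edgeset_iso G G' -> edgeset_iso (edgeset_comp F G) (edgeset_comp F G').
Proof.
move=> [f [fb fs fr fo]].
have h (p : edgeset_comp F G) : rng (val p).1 = src (f (val p).2).
  by rewrite fs comp_chain.
exists (fun p => comp_mk (h p)); split=> [|p|p|p q] //=.
- have [g fK gK] := fb.
  apply: inj_surj_bijective => [p q [E1 /(can_inj fK) E2]|p].
    exact: comp_eq.
  have hp : rng (val p).1 = src (g (val p).2) by rewrite -fs gK comp_chain.
  by exists (comp_mk hp); apply: comp_eq => //=; rewrite gK.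
- by rewrite /comp_ele /= /elt fo bij_eq.
Qed.

(** * The topology of path spaces *)

Section PathTopology.
Variable B : bratteli.
Implicit Types (x : bpath B) (A : set (bpath B)).

Lemma nbhs_cylinder x n : nbhs x (cylinder x n).
Proof.
rewrite nbhsE; exists (cylinder x n) => //; split=> //.
exists [set cylinder x n]; last by rewrite bigcup_set1.
by move=> _ ->; exists x, n.
Qed.

Lemma nbhs_cylinderP x A : nbhs x A -> exists n, cylinder x n `<=` A.
Proof.
rewrite nbhsE => -[O [[D' DD <-] [W DW Wx]] OA].
have [y [n Wy]] := DD _ DW; exists n => z zx; apply: OA; exists W => //.
move: Wx; rewrite Wy /= => yx i hi.
by rewrite zx ?yx.
Qed.

End PathTopology.

(** * The factor map induced by a premorphism *)

Section PremorphismMap.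
Variables (B C : bratteli) (pm : premorphism B C).
Local Notation f := (pm_level pm).
Local Notation F := (@pm_edges _ _ pm).

Lemma pm_edges0_eq (g g' : F 0) : g = g'.
Proof.
by have /eqP/fintype1P [u hu] := pm_edges0 pm; rewrite (hu g) (hu g').
Qed.

(** The commutation isomorphism of the premorphism at level [n], from right to
    left. *)
Definition pm_theta n := sval (cid (edgeset_iso_sym (pm_comm pm n))).

Lemma pm_thetaP n : let th := @pm_theta n in
  [/\ bijective th, forall e, src (th e) = src e, forall e, rng (th e) = rng e &
      forall e e', ele (th e) (th e') = ele e e'].
Proof. by rewrite /pm_theta; case: cid. Qed.

Implicit Types x y : bpath C.

Lemma pm_edges0_inh : {e : F 0 | True}.
Proof. by apply: cid; have /fintype1P [e _] := introT eqP (pm_edges0 pm); exists e. Qed.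

Lemma pm_state0 x : rng (sval pm_edges0_inh) = src (x (f 0)).
Proof. exact: bvert0_eq (pm_level0 pm). Qed.

Lemma pm_stateP x n (g : {g : F n | rng g = src (x (f n))}) :
  rng (sval g) = src (seg_rest (pm_levelS pm n) x).
Proof. by rewrite seg_rest_src; exact: svalP g. Qed.

(** The pair, made of an edge of [B] at level [n] and an edge of [F n.+1], that
    corresponds to an edge of [F n] followed by the segment of [x] from level
    [f n] to level [f n.+1]. *)
Definition pm_pair x n (g : {g : F n | rng g = src (x (f n))}) :
    edgeset_comp (bedges B n) (F n.+1) :=
  pm_theta (comp_mk (pm_stateP g)).

Lemma pm_pair_rng x n g :
  rng (val (@pm_pair x n g)).2 = src (x (f n.+1)).
Proof.
have [_ _ /(_ (comp_mk (pm_stateP g))) E _] := pm_thetaP n.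
by rewrite [LHS]E /= seg_rest_rng.
Qed.

(** The edge of [F n] reached when [x] is read up to level [f n]. *)
Fixpoint pm_state x n : {g : F n | rng g = src (x (f n))} :=
  match n with
  | 0 => exist (fun g : F 0 => rng g = src (x (f 0))) _ (pm_state0 x)
  | n'.+1 => exist (fun g : F n'.+1 => rng g = src (x (f n'.+1))) _
      (pm_pair_rng (pm_state x n'))
  end.

(** The two sides of the commutation isomorphism when [x] is read between levels
    [f n] and [f n.+1]. *)
Definition pm_in x n := comp_mk (pm_stateP (pm_state x n)).

Definition pm_out x n := pm_pair (pm_state x n).

Lemma pm_outE x n : pm_out x n = pm_theta (pm_in x n).
Proof. by []. Qed.

Lemma pm_out2 x n : (val (pm_out x n)).2 = sval (pm_state x n.+1).
Proof. by []. Qed.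

Lemma pm_map_chain x n :
  rng (val (pm_out x n)).1 = src (val (pm_out x n.+1)).1.
Proof.
rewrite comp_chain pm_out2.
have [_ /(_ (pm_in x n.+1)) E _ _] := pm_thetaP n.+1.
by rewrite [RHS]E.
Qed.

(** The path of [B] read along [x]. *)
Definition pm_map x : bpath B := BPath (pm_map_chain x).

Lemma pm_state_eq x y n : (forall i, i <= f n -> x i = y i) ->
  sval (pm_state x n) = sval (pm_state y n).
Proof.
elim: n => [//|n IHn] xy /=; congr (val _).2; rewrite /pm_pair; congr pm_theta.
have fn := pm_levelS pm n.
apply: comp_eq => /=.
  by apply: IHn => i hi; apply: xy; apply: leq_trans fn.
by apply: seg_rest_eq => i /andP[_]; apply: xy.
Qed.

Lemma pm_map_eq x y n : (forall i, i <= f n.+1 -> x i = y i) ->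
  pm_map x n = pm_map y n.
Proof.
move=> xy; have fn := pm_levelS pm n.
rewrite /= /pm_pair; congr (val (pm_theta _)).1; apply: comp_eq => /=.
  by apply: pm_state_eq => i hi; apply: xy; apply: leq_trans fn.
by apply: seg_rest_eq => i /andP[_]; apply: xy.
Qed.

Lemma pm_level_mono : {homo f : m n / m <= n}.
Proof. exact: homo_leq leqnn leq_trans (pm_levelS pm). Qed.

Lemma pm_map_continuous : continuous pm_map.
Proof.
move=> x A /nbhs_cylinderP [n nA]; rewrite /nbhs /=.
apply: filterS (nbhs_cylinder x (f n).+1) => y xy; apply: nA => i hi.
apply: pm_map_eq => j hj; apply: xy; rewrite ltnS.
exact: leq_trans hj (pm_level_mono _).
Qed.

(** Below level [n] the image of [x] is maximal and that of [y] minimal. *)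
Definition before x y n : Prop :=
  (forall i, i < n -> emax (pm_map x i)) /\
  (forall i, i < n -> emin (pm_map y i)).

(** Below level [n] the image of [y] is obtained from that of [x] by a Vershik
    move, which takes place at level [k]. *)
Definition after x y n : Prop := exists k,
  [/\ k < n, (forall i, i < k -> emax (pm_map x i)), ~ emax (pm_map x k) &
      [/\ esucc (pm_map x k) (pm_map y k),
        forall i, i < k -> emin (pm_map y i) &
        forall i, k < i < n -> pm_map y i = pm_map x i]].

Lemma before_rcons x y n : before x y n ->
  emax (pm_map x n) -> emin (pm_map y n) -> before x y n.+1.
Proof.
move=> [h1 h2] m1 m2; split=> i; rewrite ltnS leq_eqVlt.
  by case/predU1P=> [->|/h1].
by case/predU1P=> [->|/h2].
Qed.

Lemma after_rcons x y n : after x y n ->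
  pm_map y n = pm_map x n -> after x y n.+1.
Proof.
move=> [k [kn h1 h2 [h3 h4 h5]]] E; exists k; split=> //; first exact: ltnW.
split=> // i /andP[ki]; rewrite ltnS leq_eqVlt.
by case/predU1P=> [-> //|hi]; apply: h5; rewrite ki.
Qed.

Lemma esucc_nmax (S T : finType) (E : edgeset S T) (e e' : E) :
  esucc e e' -> ~ emax e.
Proof. by move=> [/andP[l /eqP n] _] /(_ _ l) E'; apply: n. Qed.

(** Maximal paths have maximal images, and likewise for minimal paths. *)
Lemma max_pm_map x n : max_path x ->
  (forall i, i < n -> emax (pm_map x i)) /\ emax (sval (pm_state x n)).
Proof.
move=> mx; elim: n => [|n [IH1 IH2]].
  by split=> // e _; apply: pm_edges0_eq.
have [tb _ _ tm] := pm_thetaP n.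
have /(emax_comp (@brng_surj B n)) [m1 m2] : emax (pm_out x n).
  rewrite pm_outE; apply: (iso_emax tb tm); apply: comp_emax => //.
  by apply: seg_rest_emax => i _; apply: mx.
split=> // i; rewrite ltnS leq_eqVlt => /predU1P[->|/IH1] //.
Qed.

Lemma min_pm_map x n : min_path x ->
  (forall i, i < n -> emin (pm_map x i)) /\ emin (sval (pm_state x n)).
Proof.
move=> mx; elim: n => [|n [IH1 IH2]].
  by split=> // e _; apply: pm_edges0_eq.
have [tb _ _ tm] := pm_thetaP n.
have /(emin_comp (@brng_surj B n)) [m1 m2] : emin (pm_out x n).
  rewrite pm_outE; apply: (iso_emin tb tm); apply: comp_emin => //.
  by apply: seg_rest_emin => i _; apply: mx.
split=> // i; rewrite ltnS leq_eqVlt => /predU1P[->|/IH1] //.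
Qed.

(** Let [y] be obtained from [x] by a Vershik move at level [k]. When [x] and [y]
    have been read up to level [f n], either this move has not been met, or it
    has changed the edge of [F n] but not yet the path of [B], or it has changed
    the path of [B], in which case both readings agree from then on. *)
Lemma vershik_state x y k n :
  (forall i, i < k -> emax (x i)) -> (forall i, i < k -> emin (y i)) ->
  esucc (x k) (y k) -> (forall i, k < i -> y i = x i) ->
  [\/ [/\ f n <= k, before x y n, emax (sval (pm_state x n)) &
          emin (sval (pm_state y n))],
      [/\ k < f n, before x y n &
          esucc (sval (pm_state x n)) (sval (pm_state y n))] |
      [/\ k < f n, after x y n & sval (pm_state x n) = sval (pm_state y n)]].
Proof.
move=> xm ym xy yx; elim: n => [|n IHn].
  constructor 1; split=> //; first by rewrite pm_level0.
  - by move=> e _; apply: pm_edges0_eq.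
  - by move=> e _; apply: pm_edges0_eq.
have [tb _ _ tm] := pm_thetaP n.
have fn := pm_levelS pm n.
have Bs := @brng_surj B n.
have out_succ : before x y n -> k < f n.+1 -> esucc (pm_in x n) (pm_in y n) ->
    [\/ [/\ f n.+1 <= k, before x y n.+1, emax (sval (pm_state x n.+1)) &
            emin (sval (pm_state y n.+1))],
      [/\ k < f n.+1, before x y n.+1 &
          esucc (sval (pm_state x n.+1)) (sval (pm_state y n.+1))] |
      [/\ k < f n.+1, after x y n.+1 &
          sval (pm_state x n.+1) = sval (pm_state y n.+1)]].
  move=> b kf /(iso_esucc tb tm) /(esucc_comp Bs) [[E s]|[m1 m2 s]].
    constructor 3; split=> //; exists n; case: b => b1 b2.
    split=> //; first exact: esucc_nmax s.
    by split=> // i; lia.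
  constructor 2; split=> //; exact: before_rcons.
case: IHn => [[fk b m1 m2]|[fk b s]|[fk a E]].
- have [fk'|fk'] : f n.+1 <= k \/ k < f n.+1 by lia.
    have /(emax_comp Bs) [m3 m4] : emax (pm_out x n).
      rewrite pm_outE; apply: (iso_emax tb tm); apply: comp_emax => //.
      by apply: seg_rest_emax => i hi; apply: xm; lia.
    have /(emin_comp Bs) [m5 m6] : emin (pm_out y n).
      rewrite pm_outE; apply: (iso_emin tb tm); apply: comp_emin => //.
      by apply: seg_rest_emin => i hi; apply: ym; lia.
    by constructor 1; split=> //; apply: before_rcons.
  apply: (out_succ b fk'); apply: comp_esucc2 => //=.
  by apply: (@seg_rest_esucc _ _ _ _ _ _ k) => //; rewrite fk.
- apply: (out_succ b (leq_trans fk fn)); apply: comp_esucc1 => //=.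
  by apply: seg_rest_eq => i hi; rewrite yx //; lia.
- have E' : pm_in x n = pm_in y n.
    apply: comp_eq => //=.
    by apply: seg_rest_eq => i hi; rewrite yx //; lia.
  have E'' : pm_out x n = pm_out y n by rewrite !pm_outE E'.
  constructor 3; split; first exact: leq_trans fk fn.
    by apply: after_rcons => //; rewrite /= -/(pm_out x n) E''.
  by rewrite -!pm_out2 E''.
Qed.

Lemma pm_map_step x y : vershik_step x y -> vershik_step (pm_map x) (pm_map y).
Proof.
case=> [[mx my]|[k [xm nk xy ym yx]]].
  left; split=> n; first by have [h _] := max_pm_map n.+1 mx; apply: h.
  by have [h _] := min_pm_map n.+1 my; apply: h.
have st n : before x y n \/ after x y n.
  by case: (vershik_state n xm ym xy yx) => -[]; [left|left|right].
have [mx|nmx] := pselect (max_path (pm_map x)).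
  left; split=> // n; case: (st n.+1) => [[_ b]|[j [_ _ nj _]]].
    exact: b.
  by case: nj; apply: mx.
have ex : exists k, `[< ~ emax (pm_map x k) >].
  by apply: contrapT => h; apply: nmx => n; apply: contrapT => hn;
    apply: h; exists n; apply/asboolP.
case: (ex_minnP ex) => m /asboolP nm mmin.
have aft n : m < n -> [/\ esucc (pm_map x m) (pm_map y m),
    forall i, i < m -> emin (pm_map y i) &
    forall i, m < i < n -> pm_map y i = pm_map x i].
  move=> mn; case: (st n) => [[b _]|[j [jn h1 h2 h3]]]; first by case: nm; apply: b.
  suff -> : m = j by [].
  have mj : m <= j by apply/mmin/asboolP.
  by case: (ltngtP m j) mj => // /h1.
right; exists m; have [h1 h2 _] := aft _ (ltnSn m); split=> //.
- move=> i im; apply: contrapT => /asboolP/mmin.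
  by rewrite leqNgt im.
- by move=> i mi; have [//|_ _] := aft i.+1; [exact: ltnW|apply; rewrite mi /=].
Qed.

End PremorphismMap.

(** * Preliminaries on Cantor systems *)

Section Cantor.
Variables (X : topologicalType).

Lemma cantor_compact : (exists h : X -> cantor_space, homeomorphism h) ->
  compact [set: X].
Proof.
move=> [h [_ [g [gc hK gK]]]].
have -> : [set: X] = g @` [set: cantor_space].
  by apply/seteqP; split=> // x _; exists (h x).
apply: continuous_compact cantor_space_compact.
exact: continuous_subspaceT.
Qed.

Lemma cantor_hausdorff : (exists h : X -> cantor_space, homeomorphism h) ->
  hausdorff_space X.
Proof.
move=> [h [hc [g [gc hK gK]]]] p q pq.
apply: (can_inj hK); apply: cantor_space_hausdorff => A A' /hc nA /hc nA'.
by have [z [z1 z2]] := pq _ _ nA nA'; exists (h z).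
Qed.

End Cantor.

(** The image of a minimal system under an equivariant continuous map is compact
    and invariant, hence everything. *)
Lemma factor_map_onto (X Y : topologicalType) (phi : X -> X) (psi : Y -> Y)
    (alpha : X -> Y) :
  cantor_minimal_system phi -> cantor_minimal_system psi ->
  continuous alpha -> (forall x, alpha (phi x) = psi (alpha x)) ->
  factor_map phi psi alpha.
Proof.
move=> [hX [_ [gphi [_ gK Kg]]] _] [hY _ minY] ac eq; split=> //.
have cl : closed (range alpha).
  apply: compact_closed; first exact: cantor_hausdorff.
  by apply: continuous_compact (cantor_compact hX); apply: continuous_subspaceT.
case: (minY _ cl) => [|E|//].
  apply/seteqP; split=> [_ [_ [x _ <-] <-]|_ [x _ <-]].
    by exists (phi x).
  by exists (alpha (gphi x)); [exists (gphi x)|rewrite -eq Kg].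
have [h [_ [g _]]] := hX.
have : range alpha (alpha (g point)) by exists (g point).
by rewrite E.
Qed.

Lemma premorphism_factor (X Y : topologicalType) (phi : X -> X) (psi : Y -> Y)
    (C B : bratteli) :
  cantor_minimal_system phi -> cantor_minimal_system psi ->
  bratteli_vershik_model C phi -> bratteli_vershik_model B psi ->
  premorphism B C -> exists alpha : X -> Y, factor_map phi psi alpha.
Proof.
move=> hX hY [oC [a [[_ _ aE] [_ [a' [a'c aK a'K]]]]]].
move=> [oB [b [[bc _ bE] _]]] pm.
exists (b \o pm_map pm \o a'); apply: factor_map_onto => // [|x].
  move=> x; apply: continuous_comp; first exact: a'c.
  by apply: continuous_comp; [exact: pm_map_continuous|exact: bc].
rewrite /= -bE; congr b; apply/(vershikP _ _ oB); apply: pm_map_step.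
by apply/(vershikP _ _ oC); rewrite -{1}(a'K x) -aE aK.
Qed.

(** * Locally constant functions *)

Section LocallyConstant.
Variable X : topologicalType.

(** Continuity for the discrete topology on [T]. *)
Definition loc_const (T : Type) (f : X -> T) : Prop :=
  forall x, \forall y \near x, f y = f x.

Lemma lc_cst (T : Type) (t : T) : loc_const (fun=> t).
Proof. by move=> x; apply: nearW. Qed.

Lemma lc_pair (T U : Type) (f : X -> T) (g : X -> U) :
  loc_const f -> loc_const g -> loc_const (fun x => (f x, g x)).
Proof. by move=> lf lg x; apply: filterS2 (lf x) (lg x) => y -> ->. Qed.

Lemma lc_map (T U : Type) (h : T -> U) (f : X -> T) :
  loc_const f -> loc_const (fun x => h (f x)).
Proof. by move=> lf x; apply: filterS (lf x) => y ->. Qed.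

Lemma lc_dep (T : Type) (b : X -> nat) (f : nat -> X -> T) :
  loc_const b -> (forall n, loc_const (f n)) -> loc_const (fun x => f (b x) x).
Proof. by move=> lb lf x; apply: filterS2 (lb x) (lf (b x) x) => y -> ->. Qed.

Lemma near_lt (f : nat -> X -> Prop) (x : X) N :
  (forall i, i < N -> \forall y \near x, f i y) ->
  \forall y \near x, forall i, i < N -> f i y.
Proof.
elim: N => [|N IHN] h; first by apply: nearW.
have h1 := h N (ltnSn N).
have h2 : \forall y \near x, forall i, i < N -> f i y.
  by apply: IHN => i hi; apply: h; exact: ltnW.
apply: filterS2 h1 h2 => y y1 y2 i; rewrite ltnS leq_eqVlt.
by case/predU1P=> [->|/y2].
Qed.

Lemma lc_mkseq (T : Type) (f : nat -> X -> T) n :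
  (forall i, loc_const (f i)) -> loc_const (fun x => mkseq (f^~ x) n).
Proof.
move=> lf x.
have := @near_lt (fun i y => f i y = f i x) x n (fun i _ => lf i x).
apply: filterS => y xy; apply/eq_in_map => i; rewrite mem_iota => hi.
by apply: xy.
Qed.

(** The first index at which a family of locally constant tests succeeds. *)
Lemma lc_ex_minn (u : nat -> X -> bool) (ex : forall x, exists n, u n x) :
  (forall n, loc_const (u n)) -> loc_const (fun x => ex_minn (ex x)).
Proof.
move=> lu x.
have := @near_lt (fun i y => u i y = u i x) x (ex_minn (ex x)).+1
  (fun i _ => lu i x).
apply: filterS => y; case: ex_minnP => n un nmin xy.
case: ex_minnP => m um mmin.
have mn : m <= n by apply: mmin; rewrite xy.
by apply/eqP; rewrite eqn_leq mn /= nmin // -xy.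
Qed.

Hypothesis cX : compact [set: X].

(** Compactness, in the form of an induction principle: a property of sets that
    holds of the empty set, is inherited by subsets and finite unions, and holds
    locally, holds of the whole space. *)
Lemma compact_ind (Q : set X -> Prop) : Q set0 ->
  (forall A A', A `<=` A' -> Q A' -> Q A) ->
  (forall A A', Q A -> Q A' -> Q (A `|` A')) ->
  (forall x : X, exists2 A, nbhs x A & Q A) -> Q setT.
Proof.
move=> Q0 QS QU Qloc; apply: contrapT => nQ.
pose F : set_system X := fun A => Q (~` A).
have FF : ProperFilter F.
  apply: Build_ProperFilter_ex => [A FA|].
    apply: contrapT => nA; apply: nQ; apply: QS FA => x _ Ax; apply: nA.
    by exists x.
  split; rewrite /F.
  - by rewrite setCT.
  - by move=> A A' FA FA'; rewrite setCI; apply: QU.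
  - by move=> A A' AA'; apply: QS; apply: subsetC.
have [x [_ xF]] := cX FF (filterT : F setT).
have [A nA QA] := Qloc x.
have FA : F (~` A) by rewrite /F setCK.
by have [y []] := xF _ _ FA nA.
Qed.

Lemma lc_finite_range (T : choiceType) (f : X -> T) : loc_const f ->
  exists s : seq T, forall t, t \in s <-> exists x, f x = t.
Proof.
move=> lf.
suff [s hs] : exists s : seq T, forall x, [set: X] x -> f x \in s.
  exists [seq t <- s | `[< exists x, f x = t >]] => t; rewrite mem_filter.
  split=> [/andP[/asboolP//]|h].
  by apply/andP; split; [apply/asboolP|case: h => x <-; apply: hs].
apply: (@compact_ind (fun A => exists s : seq T, forall x, A x -> f x \in s)).
- by exists [::].
- by move=> A A' AA' [s hs]; exists s => x /AA'/hs.
- move=> A A' [s hs] [s' hs']; exists (s ++ s') => x.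
  by rewrite mem_cat => -[/hs ->//|/hs' ->]; rewrite orbT.
- move=> x; exists [set y | f y = f x]; first exact: lf.
  by exists [:: f x] => y /= ->; rewrite inE.
Qed.

End LocallyConstant.

Lemma lc_comp (X Y : topologicalType) (T : Type) (f : X -> T) (g : Y -> X) :
  continuous g -> loc_const f -> loc_const (fun y => f (g y)).
Proof. by move=> gc lf y; apply: gc (lf (g y)). Qed.

(** * Kakutani-Rokhlin structures *)

(** A partition of the space into finitely many clopen towers: [ktw x] is the
    tower of [x] and [klev x] its level there, [kh v] is the height of tower
    [v]. The base of the structure is the set of points of level [0]; orbits
    climb one level at a time and go from the top of a tower to the base. *)
Record kr (X : topologicalType) (phi : X -> X) := KR {
  kV : finType;
  kh : kV -> nat;
  ktw : X -> kV;
  klev : X -> nat;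
  ktw_lc : loc_const ktw;
  klev_lc : loc_const klev;
  klev_lt : forall x, klev x < kh (ktw x);
  k_step : forall x, (klev x).+1 < kh (ktw x) ->
    klev (phi x) = (klev x).+1 /\ ktw (phi x) = ktw x;
  k_top : forall x, (klev x).+1 = kh (ktw x) -> klev (phi x) = 0;
  k_surj : forall v, exists2 x, ktw x = v & klev x = 0
}.

Section KRExistence.
Variables (X : topologicalType) (phi g : X -> X).
Hypothesis hX : cantor_minimal_system phi.
Hypotheses (gc : continuous g) (gK : cancel phi g) (Kg : cancel g phi).

Let cX : compact [set: X].
Proof. by case: hX => h _ _; apply: cantor_compact. Qed.

Let pc : continuous phi.
Proof. by case: hX => _ []. Qed.

Lemma iter_continuous (f : X -> X) n : continuous f -> continuous (iter n f).
Proof.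
move=> fc; elim: n => [|n IHn] x; first exact: cvg_id.
by apply: (@continuous_comp _ _ _ (iter n f) f); [exact: IHn|exact: fc].
Qed.

Lemma iterK n : cancel (iter n phi) (iter n g).
Proof. by elim: n => // n IHn x; rewrite iterSr [in LHS]iterS gK IHn. Qed.

Lemma iterVK n : cancel (iter n g) (iter n phi).
Proof. by elim: n => // n IHn x; rewrite iterSr [in LHS]iterS Kg IHn. Qed.

Section Return.
Variables (U : X -> bool) (x0 : X).
Hypotheses (lU : loc_const U) (Ux0 : U x0).

Let lUp n : loc_const (fun x => U (iter n phi x)).
Proof. by apply: (lc_comp (f := U) (g := iter n _)) => //; apply: iter_continuous. Qed.

Let lUg n : loc_const (fun x => U (iter n g x)).
Proof. by apply: (lc_comp (f := U) (g := iter n _)) => //; apply: iter_continuous. Qed.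

(** By minimality every two-sided orbit visits [U]; by compactness it does so
    within a bounded time, so that both half-orbits visit [U]. *)
Lemma visit_bounded : exists N, forall x,
  exists2 n, n <= N & U (iter n phi x) || U (iter n g x).
Proof.
have visits x : exists n, U (iter n phi x) || U (iter n g x).
  pose A := [set y | forall n, ~~ (U (iter n phi y) || U (iter n g y))].
  have Acl : closed A.
    move=> y Ay n; have [z [zA /= zy]] := Ay _ (lc_pair (lUp n) (lUg n) y).
    by case: zy => <- <-; apply: zA.
  have AP y : A (phi y) <-> A y.
    split=> h n.
      have := h n.+1; rewrite [iter _ g _]iterSr gK negb_or => /andP[_ h2].
      have := h n.-1; rewrite -iterSr => /norP[h1 _].
      apply/norP; split=> //; case: n h1 {h2} => // _; have := h 1.
      by rewrite /= gK => /norP[].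
    have := h n.+1; rewrite iterSr => /norP[h1 _].
    apply/norP; split=> //; case: n {h1} => [|n].
      by have /norP[] := h 1.
    by rewrite iterSr gK; have /norP[] := h n.
  case: hX => _ _ /(_ A Acl) [|A0|AT].
  - apply/seteqP; split=> [_ [y Ay <-]|y Ay]; first exact/AP.
    by exists (g y) => //; apply/AP; rewrite Kg.
  - apply: contrapT => nh; suff : A x by rewrite A0.
    by move=> n; apply/negP => h; apply: nh; exists n.
  - have : A x0 by rewrite AT.
    by move=> /(_ 0); rewrite /= Ux0.
suff [N hN] : exists N, forall x, [set: X] x ->
    exists2 n, n <= N & U (iter n phi x) || U (iter n g x).
  by exists N => x; apply: hN.
apply: (compact_ind cX (Q := fun A => exists N, forall x, A x ->
    exists2 n, n <= N & U (iter n phi x) || U (iter n g x))).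
- by exists 0.
- by move=> A A' AA' [N hN]; exists N => x /AA' /hN.
- move=> A A' [N hN] [N' hN']; exists (maxn N N') => x [/hN|/hN'] [n nN h].
    by exists n; rewrite // leq_max nN.
  by exists n; rewrite // leq_max nN orbT.
- move=> x; have [n hn] := visits x.
  exists [set y | (U (iter n phi y), U (iter n g y)) =
                  (U (iter n phi x), U (iter n g x))].
    exact: lc_pair (lUp n) (lUg n) x.
  by exists n => y /= [E1 E2]; exists n; rewrite ?E1 ?E2.
Qed.

Lemma visit_backward x : exists n, U (iter n g x).
Proof.
have [N hN] := visit_bounded.
have [n nN /orP[]] := hN (iter N g x); last by rewrite -iterD; exists (n + N).
by rewrite -{1}(subnKC nN) iterD iterVK; exists (N - n).
Qed.

Lemma visit_forward x : exists n, U (iter n.+1 phi x).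
Proof.
have [N hN] := visit_bounded.
have [n nN /orP[]] := hN (iter N.+1 phi x).
  by rewrite -iterD addnS; exists (n + N).
rewrite -{1}(subnKC nN) -addnS iterD iterK; by exists (N - n).
Qed.

(** The time since the last visit to [U], present included; the time until the
    next visit, present excluded, minus one; the point of the last visit. *)
Definition back_time x := ex_minn (visit_backward x).
Definition fwd_time x := ex_minn (visit_forward x).
Definition base_pt x := iter (back_time x) g x.

Lemma back_time_lc : loc_const back_time.
Proof. exact: lc_ex_minn lUg. Qed.

Lemma fwd_time_lc : loc_const fwd_time.
Proof. by apply: lc_ex_minn => n; apply: lUp. Qed.

Lemma base_ptU x : U (base_pt x).
Proof. by rewrite /base_pt /back_time; case: ex_minnP. Qed.

Lemma base_ptK x : iter (back_time x) phi (base_pt x) = x.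
Proof. exact: iterVK. Qed.

Lemma back_time0 x : (back_time x == 0) = U x.
Proof.
rewrite /back_time; case: ex_minnP => -[|n] Un nmin //; apply/esym/negP => Ux.
by have := nmin 0 Ux.
Qed.

Lemma base_pt_id x : U x -> base_pt x = x.
Proof. by rewrite -back_time0 /base_pt => /eqP ->. Qed.

Lemma back_timeS x : ~~ U (phi x) -> back_time (phi x) = (back_time x).+1.
Proof.
move=> nU; rewrite /back_time; case: ex_minnP => -[|n] Un nmin.
  by rewrite Un in nU.
case: ex_minnP => m Um mmin.
rewrite iterSr gK in Un; have := mmin _ Un.
have := nmin m.+1; rewrite iterSr gK => /(_ Um).
by move=> h1 h2; apply/eqP; rewrite eqn_leq h1 /= ltnS.
Qed.

Lemma back_time_le x : back_time x <= fwd_time (base_pt x).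
Proof.
rewrite leqNgt; apply/negP => fb.
have : U (iter (fwd_time (base_pt x)).+1 phi (base_pt x)).
  by rewrite /fwd_time; case: ex_minnP.
rewrite {2}/base_pt -{1}(subnKC fb) iterD iterVK => Ub.
suff : back_time x <= back_time x - (fwd_time (base_pt x)).+1 by lia.
by rewrite {1}/back_time; case: ex_minnP => b _; apply.
Qed.

Lemma visit_next x : back_time x = fwd_time (base_pt x) -> U (phi x).
Proof.
move=> E; rewrite -{1}(base_ptK x) -iterS E.
by rewrite /fwd_time; case: ex_minnP.
Qed.

Lemma not_visit_next x : back_time x < fwd_time (base_pt x) -> ~~ U (phi x).
Proof.
move=> lt; apply/negP; rewrite -{1}(base_ptK x) -iterS => Ux.
suff : fwd_time (base_pt x) <= back_time x by lia.
by rewrite /fwd_time; case: ex_minnP => f _; apply.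
Qed.

(* Towers are labelled by the values taken by [c] between two visits. *)
Variables (T : choiceType) (c : X -> T).
Hypothesis lc : loc_const c.

Let lab_at (b : nat) (x : X) : seq T :=
  mkseq (fun i => c (iter i phi (iter b g x))) (fwd_time (iter b g x)).+1.

(** The label of the tower of [x]. *)
Definition label x : seq T := lab_at (back_time x) x.

Lemma label_lc : loc_const label.
Proof.
apply: lc_dep back_time_lc _ => b.
apply: (lc_comp (f := fun y => mkseq (fun i => c (iter i phi y)) (fwd_time y).+1)).
  exact: iter_continuous.
apply: (lc_dep (f := fun n y => mkseq (fun i => c (iter i phi y)) n.+1)).
  exact: fwd_time_lc.
move=> n; apply: lc_mkseq => i.
by apply: (lc_comp (f := c) (g := iter i _)) => //; apply: iter_continuous.
Qed.

Lemma size_label x : size (label x) = (fwd_time (base_pt x)).+1.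
Proof. by rewrite size_mkseq. Qed.

Lemma label_nth x : c x = nth (c x) (label x) (back_time x).
Proof.
by rewrite nth_mkseq ?ltnS ?back_time_le // -/(base_pt x) base_ptK.
Qed.

Lemma label_base x y : base_pt y = base_pt x -> label y = label x.
Proof. by rewrite /label /lab_at -!/(base_pt _) => ->. Qed.

Lemma base_phi x : ~~ U (phi x) -> base_pt (phi x) = base_pt x.
Proof. by move=> nU; rewrite /base_pt back_timeS // iterSr gK. Qed.

(** Over any nonempty clopen set [U] there is a structure with base [U] whose
    levels determine a given locally constant function: cut each orbit at its
    visits to [U], and group the pieces by the values of [c] along them. *)
Lemma kr_exists : exists K : kr phi,
  (forall x, (klev K x == 0) = U x) /\
  (forall x x', ktw K x = ktw K x' -> klev K x = klev K x' -> c x = c x').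
Proof.
have [s hs] := lc_finite_range cX label_lc.
have ins x : label x \in s by apply/hs; exists x.
pose tw x : seq_sub s := SeqSub (ins x).
pose h (v : seq_sub s) := size (ssval v).
have twE x y : label y = label x -> tw y = tw x by move=> E; apply/val_inj.
have hE x : h (tw x) = (fwd_time (base_pt x)).+1 := size_label x.
have p1 : loc_const tw.
  by move=> x; apply: filterS (label_lc x) => y; apply: twE.
have p2 x : back_time x < h (tw x) by rewrite hE ltnS back_time_le.
have p3 x : (back_time x).+1 < h (tw x) ->
    back_time (phi x) = (back_time x).+1 /\ tw (phi x) = tw x.
  rewrite hE ltnS => /not_visit_next nU.
  by rewrite back_timeS //; split=> //; apply/twE/label_base/base_phi.
have p4 x : (back_time x).+1 = h (tw x) -> back_time (phi x) = 0.
  by rewrite hE => -[/visit_next]; rewrite -back_time0 => /eqP.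
have p5 v : exists2 x, tw x = v & back_time x = 0.
  case: v => l ls; have [x xl] := (hs l).1 ls.
  have Ub := base_ptU x; exists (base_pt x); last by apply/eqP; rewrite back_time0.
  by apply/val_inj; rewrite /= -xl; apply: label_base; apply: base_pt_id.
exists (KR p1 back_time_lc p2 p3 p4 p5); split=> [x|x x' E1 E2].
  exact: back_time0.
have {}E1 : label x = label x' := congr1 (@ssval _ _) E1.
have {}E2 : back_time x = back_time x' := E2.
rewrite (label_nth x) (label_nth x') E1 E2; apply: set_nth_default.
by rewrite size_label ltnS back_time_le.
Qed.

End Return.
End KRExistence.

(** * Passages of towers through towers *)

Section KRLemmas.
Variables (X : topologicalType) (phi : X -> X) (Q : kr phi).

(** Moving backwards inside a tower. *)
Lemma k_back x : klev Q (phi x) != 0 ->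
  klev Q (phi x) = (klev Q x).+1 /\ ktw Q (phi x) = ktw Q x.
Proof.
move=> n0; have := klev_lt Q x; rewrite leq_eqVlt => /predU1P[E|/k_step //].
by rewrite (k_top E) in n0.
Qed.

(** Moving upwards from the base. *)
Lemma k_climb x i : klev Q x = 0 -> i < kh (ktw Q x) ->
  klev Q (iter i phi x) = i /\ ktw Q (iter i phi x) = ktw Q x.
Proof.
move=> x0; elim: i => [//|i IHi] hi; have [E1 E2] := IHi (ltnW hi).
by have := @k_step _ _ Q (iter i phi x); rewrite E1 E2 => /(_ hi) [].
Qed.

End KRLemmas.

(** [Q] refines the pull-back of [P]: points on the same level of the same tower
    of [Q] lie over the same level of the same tower of [P], and the base of [Q]
    lies over the base of [P]. *)
Definition refines (X Y : topologicalType) (phi : X -> X) (psi : Y -> Y)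
    (alpha : X -> Y) (P : kr psi) (Q : kr phi) : Prop :=
  (forall x x', ktw Q x = ktw Q x' -> klev Q x = klev Q x' ->
     ktw P (alpha x) = ktw P (alpha x') /\ klev P (alpha x) = klev P (alpha x'))
  /\ (forall x, klev Q x = 0 -> klev P (alpha x) = 0).

Section Passages.
Variables (X Y : topologicalType) (phi : X -> X) (psi : Y -> Y).
Variables (alpha : X -> Y) (P : kr psi) (Q : kr phi).

(** A bound on the heights of the towers of [Q], used to store levels in a finite
    type. *)
Definition kmax := \max_(w : kV Q) kh w.

Lemma klev_kmax x : klev Q x < kmax.+1.
Proof. exact/ltnW/(leq_trans (klev_lt Q x))/leq_bigmax. Qed.

Definition kedge_pred (p : kV Q * 'I_kmax.+1) : bool :=
  `[< exists x, [/\ ktw Q x = p.1, klev Q x = p.2 & klev P (alpha x) = 0] >].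

Definition kedge : finType := {p | kedge_pred p}.

Implicit Types e : kedge.

(** A point of the source lying at the start of the passage [e]. *)
Definition kpt e : X := sval (cid (asboolW (svalP e))).
Definition ksrc e : kV P := ktw P (alpha (kpt e)).
Definition krng e : kV Q := (val e).1.
Definition kpos e : nat := (val e).2.
Definition kele : rel kedge :=
  fun e e' => (krng e == krng e') && (kpos e <= kpos e').

Lemma kptP e :
  [/\ ktw Q (kpt e) = krng e, klev Q (kpt e) = kpos e &
      klev P (alpha (kpt e)) = 0].
Proof. by rewrite /kpt; case: cid. Qed.

Lemma kedge_eq e e' : krng e = krng e' -> kpos e = kpos e' -> e = e'.
Proof.
move=> E1 E2; apply/val_inj; rewrite [val e]surjective_pairing.
by rewrite [val e']surjective_pairing; congr (_, _) => //; apply/val_inj.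
Qed.

Fact kele_refl : reflexive kele.
Proof. by move=> e; rewrite /kele eqxx leqnn. Qed.

Fact kele_anti : antisymmetric kele.
Proof.
move=> e e' /andP[/andP[/eqP E l] /andP[_ l']].
by apply: kedge_eq => //; apply/eqP; rewrite eqn_leq l.
Qed.

Fact kele_trans : transitive kele.
Proof.
move=> e2 e1 e3 /andP[/eqP E l] /andP[/eqP E' l'].
by rewrite /kele E E' eqxx (leq_trans l).
Qed.

Fact kele_comparable e e' : (kele e e' || kele e' e) = (krng e == krng e').
Proof.
by rewrite /kele [krng e' == _]eq_sym -andb_orr leq_total andbT.
Qed.

(** The ordered edge set of [P]-towers crossed by [Q]-towers: an edge is a tower
    of [Q] together with a level in it lying over the base of [P]; it starts at
    the tower of [P] above that part of the base. *)
Definition kedges : edgeset (kV P) (kV Q) :=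
  @EdgeSet _ _ kedge ksrc krng kele kele_refl kele_anti kele_trans
    kele_comparable.

Lemma kelt_pos (e e' : kedges) :
  elt e e' = (krng e == krng e') && (kpos e < kpos e').
Proof.
rewrite /elt /= /kele -andbA; case: (krng e =P krng e') => //= E.
rewrite ltn_neqAle andbC; congr (~~ _ && _).
by apply/eqP/eqP => [->//|]; apply: kedge_eq.
Qed.

Hypothesis PQ : refines alpha P Q.
Hypothesis equi : forall x, alpha (phi x) = psi (alpha x).
Hypothesis phi_onto : forall x, exists x', phi x' = x.

Lemma ksrcE e x : ktw Q x = krng e -> klev Q x = kpos e -> ksrc e = ktw P (alpha x).
Proof.
have [h1 h2 _] := kptP e; rewrite -h1 -h2 => E1 E2.
by rewrite /ksrc; have [] := PQ.1 _ _ E1 E2.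
Qed.

(** Any point is preceded in its [Q]-tower by the start of its passage through
    a tower of [P]. *)
Lemma passage_start x : exists s,
  [/\ klev P (alpha s) = 0, ktw P (alpha s) = ktw P (alpha x),
      ktw Q s = ktw Q x & klev Q s + klev P (alpha x) = klev Q x].
Proof.
move Ei : (klev P (alpha x)) => i; elim: i x Ei => [|i IHi] x Ei.
  by exists x; rewrite addn0.
have [x' x'x] := phi_onto x; rewrite -x'x in Ei *.
have [|E1 E2] := @k_back _ _ P (alpha x'); first by rewrite -equi Ei.
have [|E3 E4] := @k_back _ _ Q x'.
  by apply/eqP => /PQ.2; rewrite Ei.
rewrite -equi in E1 E2; rewrite Ei in E1; case: E1 => /esym/IHi [s [s1 s2 s3 s4]].
by exists s; split; rewrite ?E2 ?E4 // E3 addnS s4.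
Qed.

Lemma klev_le x : klev P (alpha x) <= klev Q x.
Proof. by have [s [_ _ _ <-]] := passage_start x; rewrite leq_addl. Qed.

Lemma edge_of_ok x :
  kedge_pred (ktw Q x, inord (klev Q x - klev P (alpha x))).
Proof.
apply/asboolP; have [s [s1 s2 s3 s4]] := passage_start x.
exists s; split=> //=; rewrite inordK; first by rewrite -s4 addnK.
exact: leq_ltn_trans (leq_subr _ _) (klev_kmax x).
Qed.

(** The passage to which a point belongs. *)
Definition edge_of x : kedges := exist kedge_pred _ (edge_of_ok x).

Lemma edge_of_rng x : krng (edge_of x) = ktw Q x.
Proof. by []. Qed.

Lemma edge_of_pos x : kpos (edge_of x) = klev Q x - klev P (alpha x).
Proof.
rewrite /kpos /= inordK //.
exact: leq_ltn_trans (leq_subr _ _) (klev_kmax x).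
Qed.

Lemma edge_of_posD x : kpos (edge_of x) + klev P (alpha x) = klev Q x.
Proof. by rewrite edge_of_pos subnK // klev_le. Qed.

Lemma edge_of_src x : ksrc (edge_of x) = ktw P (alpha x).
Proof.
have [s [s1 s2 s3 s4]] := passage_start x.
rewrite -s2; apply: ksrcE; first by rewrite s3.
by rewrite edge_of_pos -s4 addnK.
Qed.

Lemma edge_of_eq x x' : ktw Q x = ktw Q x' -> klev Q x = klev Q x' ->
  edge_of x = edge_of x'.
Proof.
move=> E1 E2; have [_ E3] := PQ.1 _ _ E1 E2.
by apply: kedge_eq; rewrite ?edge_of_rng // !edge_of_pos E2 E3.
Qed.

Lemma edge_ofP e : exists2 x, klev P (alpha x) = 0 & e = edge_of x.
Proof.
have [h1 h2 h3] := kptP e; exists (kpt e) => //.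
by apply: kedge_eq; rewrite ?edge_of_rng // edge_of_pos h3 subn0.
Qed.

(** From the start of a passage the orbit follows both towers. *)
Lemma passage_climb x i : klev P (alpha x) = 0 -> i < kh (ktw P (alpha x)) ->
  [/\ klev P (alpha (iter i phi x)) = i,
      ktw P (alpha (iter i phi x)) = ktw P (alpha x),
      klev Q (iter i phi x) = klev Q x + i &
      ktw Q (iter i phi x) = ktw Q x].
Proof.
have ai j : alpha (iter j phi x) = iter j psi (alpha x).
  by elim: j => //= j IHj; rewrite equi IHj.
move=> x0; elim: i => [|i IHi] hi; first by rewrite addn0.
have [_ _ E3 E4] := IHi (ltnW hi).
have [E1 E2] := k_climb x0 hi; rewrite ai.
have [|E5 E6] := @k_back _ _ Q (iter i phi x).
  by apply/eqP => /PQ.2; rewrite -iterS ai E1.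
by split=> //; rewrite iterS ?E5 ?E6 // E3 addnS.
Qed.

(** Consecutive passages do not overlap. *)
Lemma passage_gap (e e' : kedges) : elt e e' ->
  kpos e + kh (ksrc e) <= kpos e'.
Proof.
rewrite kelt_pos => /andP[/eqP E l]; rewrite leqNgt; apply/negP => gap.
have [h1 h2 h3] := kptP e; have [h1' h2' h3'] := kptP e'.
have hi : kpos e' - kpos e < kh (ktw P (alpha (kpt e))) by rewrite -/(ksrc e); lia.
have [E1 E2 E3 E4] := passage_climb h3 hi.
have E5 : ktw Q (iter (kpos e' - kpos e) phi (kpt e)) = ktw Q (kpt e').
  by rewrite E4 h1 h1'.
have E6 : klev Q (iter (kpos e' - kpos e) phi (kpt e)) = klev Q (kpt e').
  by rewrite E3 h2 h2' subnKC // ltnW.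
by have [_] := PQ.1 _ _ E5 E6; rewrite E1 h3'; lia.
Qed.

Lemma passage_end (e : kedges) : kpos e + kh (ksrc e) <= kh (krng e).
Proof.
have [h1 h2 h3] := kptP e.
have h0 : 0 < kh (ksrc e) by apply: leq_ltn_trans (klev_lt P _).
have [] := @passage_climb (kpt e) (kh (ksrc e)).-1 h3; first by rewrite -/(ksrc e); lia.
move=> _ _ E3 E4; have := klev_lt Q (iter (kh (ksrc e)).-1 phi (kpt e)).
by rewrite E3 E4 h1 h2; lia.
Qed.

Lemma kedges_rng_surj (w : kV Q) : exists e : kedges, rng e = w.
Proof. by have [x xw _] := k_surj w; exists (edge_of x). Qed.

Lemma kedges_src_surj : (forall y, exists x, alpha x = y) ->
  forall v : kV P, exists e : kedges, src e = v.
Proof.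
move=> onto v; have [y yv _] := k_surj v; have [x xy] := onto y.
by exists (edge_of x); rewrite [LHS]edge_of_src xy.
Qed.

Lemma emin_kpos (e : kedges) : emin e <-> kpos e = 0.
Proof.
split=> [m|e0 e' /andP[/eqP E l]]; last by apply: kedge_eq => //; lia.
have [x xw x0] := k_surj (krng e).
have p0 : kpos (edge_of x) = 0 by rewrite edge_of_pos x0.
suff <- : edge_of x = e by [].
by apply: m; rewrite /= /kele edge_of_rng xw eqxx p0.
Qed.

Lemma emax_kpos (e : kedges) : emax e <-> kpos e + kh (ksrc e) = kh (krng e).
Proof.
split=> [m|E e' l]; last first.
  apply/eqP/negP => /negP n.
  have /passage_gap : elt e e' by rewrite /elt l eq_sym n.
  have := passage_end e'; rewrite E -(ele_rng l : krng e = krng e').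
  have := klev_lt P (alpha (kpt e')); rewrite -/(ksrc e'); lia.
have [h1 h2 h3] := kptP e.
have h0 : 0 < kh (ksrc e) by apply: leq_ltn_trans (klev_lt P _).
have [] := @passage_climb (kpt e) (kh (ksrc e)).-1 h3; first by rewrite -/(ksrc e); lia.
set t := iter _ _ _ => E1 E2 E3 E4.
apply/eqP; rewrite eqn_leq passage_end leqNgt; apply/negP => lt.
have [|E5 E6] := @k_step _ _ Q t; first by rewrite E3 E4 h1 h2; lia.
have E7 : klev P (alpha (phi t)) = 0.
  by rewrite equi; apply: k_top; rewrite E1 E2 -/(ksrc e); lia.
have p : kpos (edge_of (phi t)) = kpos e + kh (ksrc e).
  by rewrite edge_of_pos E7 E5 E3 h2; lia.
have : edge_of (phi t) = e.
  by apply: m; rewrite /= /kele edge_of_rng E6 E4 h1 eqxx p leq_addr.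
by move=> E; move: p; rewrite E; lia.
Qed.

End Passages.

Section PassageComposition.
Variables (X Y Z : topologicalType).
Variables (phi : X -> X) (psi : Y -> Y) (chi : Z -> Z).
Variables (alpha : Y -> Z) (beta : X -> Y).
Variables (P : kr chi) (Q : kr psi) (R : kr phi).
Hypotheses (PQ : refines alpha P Q) (QR : refines beta Q R).
Hypothesis equia : forall y, alpha (psi y) = chi (alpha y).
Hypothesis equib : forall x, beta (phi x) = psi (beta x).
Hypothesis psi_onto : forall x, exists x', psi x' = x.
Hypothesis phi_onto : forall x, exists x', phi x' = x.

Local Notation F := (kedges alpha P Q).
Local Notation G := (kedges beta Q R).
Local Notation gamma := (fun x => alpha (beta x)).

Lemma refines_comp : refines gamma P R.
Proof.
split=> [x x' E1 E2|x /QR.2/PQ.2 //].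
by have [] := QR.1 _ _ E1 E2; apply: PQ.1.
Qed.

Let equic x : gamma (phi x) = chi (gamma x).
Proof. by rewrite /= equib equia. Qed.

Lemma comp_edge_pt (p : edgeset_comp F G) : exists x,
  [/\ klev P (gamma x) = 0, ktw P (gamma x) = ksrc (val p).1,
      ktw R x = krng (val p).2 & klev R x = kpos (val p).1 + kpos (val p).2].
Proof.
have h := comp_chain p; case: (val p) h => e g /= h.
have [x x0 gx] := edge_ofP QR equib phi_onto g.
have xe : ktw Q (beta x) = krng e by rewrite [RHS]h gx edge_of_src.
have [e1 e2 e3] := kptP e.
have lt : kpos e < kh (ktw Q (beta x)) by rewrite -e2 xe -e1 klev_lt.
have [E1 E2 E3 E4] := passage_climb QR equib x0 lt.
have Etw : ktw Q (beta (iter (kpos e) phi x)) = ktw Q (kpt e).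
  by rewrite E2 xe e1.
have Elev : klev Q (beta (iter (kpos e) phi x)) = klev Q (kpt e).
  by rewrite E1 e2.
have [E5 E6] := PQ.1 _ _ Etw Elev.
exists (iter (kpos e) phi x); split.
- by rewrite E6.
- by rewrite E5.
- by rewrite E4 gx edge_of_rng.
- by rewrite E3 gx edge_of_pos x0 subn0 addnC.
Qed.

(** The passage through an [R]-tower given by a passage through a [Q]-tower
    followed by a passage of that tower: levels add up. *)
Definition comp_edge_map (p : edgeset_comp F G) : kedges gamma P R :=
  edge_of refines_comp equic phi_onto (sval (cid (comp_edge_pt p))).

Lemma comp_edge_map_rng p : krng (comp_edge_map p) = krng (val p).2.
Proof. by rewrite edge_of_rng; case: cid => x []. Qed.

Lemma comp_edge_map_src p : ksrc (comp_edge_map p) = ksrc (val p).1.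
Proof. by rewrite edge_of_src; case: cid => x []. Qed.

Lemma comp_edge_map_pos p :
  kpos (comp_edge_map p) = kpos (val p).1 + kpos (val p).2.
Proof. by rewrite edge_of_pos; case: cid => x [/= E _ _ ->]; rewrite E subn0. Qed.

(** Passages compose: a passage of a [P]-tower through an [R]-tower takes place
    inside a unique passage of a [Q]-tower. *)
Lemma kedges_comp :
  edgeset_iso (edgeset_comp F G) (kedges gamma P R).
Proof.
apply: (@edgeset_iso_of_mono _ _ _ _ comp_edge_map).
- move=> e; have [x x0 ->] := edge_ofP refines_comp equic phi_onto e.
  pose e1 : F := edge_of PQ equia psi_onto (beta x).
  pose e2 : G := edge_of QR equib phi_onto x.
  have h : rng e1 = src e2 by rewrite [RHS]edge_of_src.
  exists (comp_mk h); apply: kedge_eq.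
    by rewrite comp_edge_map_rng.
  rewrite comp_edge_map_pos /= !edge_of_pos x0 !subn0.
  by rewrite subnKC // klev_le.
- exact: comp_edge_map_src.
- exact: comp_edge_map_rng.
move=> p q; rewrite comp_eltE [elt (comp_edge_map _) _]kelt_pos.
rewrite !comp_edge_map_rng !comp_edge_map_pos.
case/orP=> [l|/andP[/eqP E]]; last first.
  by rewrite kelt_pos E eqxx ltn_add2r => /andP[].
have gap := passage_gap QR equib l.
move: (l); rewrite kelt_pos => /andP[-> _] /=.
have lt : kpos (val p).1 < kh (ksrc (val p).2).
  have [h1 h2 _] := kptP (val p).1.
  by rewrite -(comp_chain p : krng _ = ksrc _) -h1 -h2 klev_lt.
apply: leq_trans (leq_trans _ gap) (leq_addl _ _).
by rewrite addnC ltn_add2l.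
Qed.

End PassageComposition.

(** * The Bratteli diagram of a sequence of Kakutani-Rokhlin structures *)

(** A refining sequence of structures, starting with the trivial one, that
    separates points and whose bases shrink to a single point. *)
Record kr_seq (X : topologicalType) (phi : X -> X) := KRSeq {
  ks :> nat -> kr phi;
  ks_pt : X;
  ks_card0 : #|kV (ks 0)| = 1;
  ks_kh0 : forall v : kV (ks 0), kh v = 1;
  ks_ref : forall n, refines (fun x => x) (ks n) (ks n.+1);
  ks_base : forall x, (forall n, klev (ks n) x = 0) <-> x = ks_pt;
  ks_sep : forall x y,
    (forall n, ktw (ks n) x = ktw (ks n) y /\ klev (ks n) x = klev (ks n) y) ->
    x = y
}.

Section Model.
Variables (X : topologicalType) (phi : X -> X) (K : kr_seq phi).
Hypothesis hX : cantor_minimal_system phi.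

Let cX : compact [set: X].
Proof. by case: hX => h _ _; apply: cantor_compact. Qed.

Lemma phi_onto : forall x, exists x', phi x' = x.
Proof. by case: hX => _ [_ [g [_ _ Kg]]] _ x; exists (g x). Qed.

Let equi x : (fun x => x) (phi x) = phi ((fun x => x) x).
Proof. by []. Qed.

(** The edges between levels [n] and [n.+1] are the passages for the identity
    map. *)
Definition ks_edges n : edgeset (kV (K n)) (kV (K n.+1)) :=
  kedges (fun x => x) (K n) (K n.+1).

(** The passage of [x] through the [n]-th structure inside the next one. *)
Definition ks_edge n (x : X) : ks_edges n :=
  edge_of (ks_ref K n) equi phi_onto x.

Lemma ks_edge_src n x : src (ks_edge n x) = ktw (K n) x.
Proof. exact: edge_of_src. Qed.

Lemma ks_edge_rng n x : rng (ks_edge n x) = ktw (K n.+1) x.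
Proof. exact: edge_of_rng. Qed.

Lemma ks_edge_pos n x : kpos (ks_edge n x) + klev (K n) x = klev (K n.+1) x.
Proof. exact: edge_of_posD. Qed.

Fact ks_vert_gt0 n : 0 < #|kV (K n)|.
Proof. by apply/card_gt0P; exists (ktw (K n) (ks_pt K)). Qed.

Fact ks_edges_gt0 n : 0 < #|ks_edges n|.
Proof. by apply/card_gt0P; exists (ks_edge n (ks_pt K)). Qed.

Fact ks_src_surj n (v : kV (K n)) : exists e : ks_edges n, src e = v.
Proof.
by apply: (kedges_src_surj (ks_ref K n) equi phi_onto) => y; exists y.
Qed.

Fact ks_rng_surj n (v : kV (K n.+1)) : exists e : ks_edges n, rng e = v.
Proof. exact: kedges_rng_surj (ks_ref K n) equi phi_onto v. Qed.

(** Vertices are towers, edges are passages between consecutive structures. *)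
Definition ks_bratteli : bratteli :=
  @Bratteli (fun n => kV (K n)) ks_edges ks_vert_gt0 (ks_card0 K) ks_edges_gt0
    ks_src_surj ks_rng_surj.

Fact ks_path_chain x n : rng (ks_edge n x) = src (ks_edge n.+1 x).
Proof. by rewrite ks_edge_src ks_edge_rng. Qed.

(** The itinerary of a point. *)
Definition ks_path x : bpath ks_bratteli :=
  @BPath ks_bratteli (fun n => ks_edge n x) (ks_path_chain x).

Lemma ks_lev0 x : klev (K 0) x = 0.
Proof. by have := klev_lt (K 0) x; rewrite ks_kh0; case: klev. Qed.

Lemma ks_tw0 x y : ktw (K 0) x = ktw (K 0) y.
Proof.
have /eqP/fintype1P [u hu] := ks_card0 K.
by rewrite (hu (ktw _ x)) (hu (ktw _ y)).
Qed.

Lemma ks_atom_le n m x y : n <= m ->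
  ktw (K m) x = ktw (K m) y -> klev (K m) x = klev (K m) y ->
  ktw (K n) x = ktw (K n) y /\ klev (K n) x = klev (K n) y.
Proof.
elim: m => [|m IHm]; first by case: n.
rewrite leq_eqVlt => /predU1P[-> //|nm] E1 E2.
by have [E3 E4] := (ks_ref K m).1 _ _ E1 E2; apply: IHm.
Qed.

Lemma ks_path_atoms x y m : (forall n, n <= m -> ks_edge n x = ks_edge n y) ->
  ktw (K m) x = ktw (K m) y /\ klev (K m) x = klev (K m) y.
Proof.
move=> xy; split; first by rewrite -!ks_edge_src xy.
elim: m xy => [|m IHm] xy; first by rewrite !ks_lev0.
by rewrite -!ks_edge_pos xy // IHm // => n nm; apply: xy; apply: leqW.
Qed.

Lemma ks_edge_eq x y m :
  ktw (K m.+1) x = ktw (K m.+1) y -> klev (K m.+1) x = klev (K m.+1) y ->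
  ks_edge m x = ks_edge m y.
Proof. exact: edge_of_eq. Qed.

Lemma ks_edge_lc n : loc_const (ks_edge n).
Proof.
move=> x; apply: filterS2 (ktw_lc (K n.+1) x) (klev_lc (K n.+1) x) => y.
exact: ks_edge_eq.
Qed.

Lemma ks_path_inj : injective ks_path.
Proof.
move=> x y xy; apply: (ks_sep (k := K)) => n; apply: ks_path_atoms => m _.
exact: (congr1 (fun p : bpath ks_bratteli => p m) xy).
Qed.

Lemma ks_path_continuous : continuous ks_path.
Proof.
move=> x A /nbhs_cylinderP [n nA]; rewrite /nbhs /=.
have := @near_lt _ (fun i y => ks_edge i y = ks_edge i x) x n
  (fun i _ => ks_edge_lc i x).
by apply: filterS => y xy; apply: nA.
Qed.

(** Every finite path is the beginning of an itinerary. *)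
Lemma ks_path_prefix (p : bpath ks_bratteli) n :
  exists x, (forall i, i < n -> ks_edge i x = p i) /\ ktw (K n) x = src (p n).
Proof.
elim: n => [|n [x [xp xn]]].
  exists (ks_pt K); split=> //; have /eqP/fintype1P [u hu] := ks_card0 K.
  by rewrite (hu (ktw _ _)) (hu (src _)).
have [z z0 pz] := edge_ofP (ks_ref K n) equi phi_onto (p n).
have zx : ktw (K n) z = ktw (K n) x.
  by rewrite xn pz [RHS]edge_of_src.
have lt : klev (K n) x < kh (ktw (K n) z) by rewrite zx klev_lt.
have [/= E1 E2 E3 E4] := passage_climb (ks_ref K n) equi z0 lt.
rewrite zx in E2; set y := iter _ _ _ in E1 E2 E3 E4.
have pos : kpos (p n) = klev (K n.+1) z.
  by rewrite pz edge_of_pos z0 subn0.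
have En : ks_edge n y = p n.
  apply: kedge_eq; first by rewrite [LHS]ks_edge_rng E4 pz [RHS]edge_of_rng.
  by apply: (@addIn (klev (K n) y)); rewrite ks_edge_pos E3 E1 pos.
exists y; split; last by rewrite -ks_edge_rng En; apply: (pedge_chain p n).
move=> i; rewrite ltnS leq_eqVlt => /predU1P[-> //|hi].
rewrite -xp //; have [] := @ks_atom_le i.+1 n y x hi E2 E1.
exact: ks_edge_eq.
Qed.

Lemma ks_path_surj (p : bpath ks_bratteli) : exists x, ks_path x = p.
Proof.
suff [x xp] : exists x, forall i, ks_edge i x = p i.
  by exists x; apply: bpath_eq.
apply: contrapT => no.
suff [n hn] : exists n, forall x, [set: X] x ->
    ~ (forall i, i < n -> ks_edge i x = p i).
  by have [x [xp _]] := ks_path_prefix p n; apply: (hn x).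
apply: (compact_ind cX (Q := fun A => exists n, forall x, A x ->
    ~ (forall i, i < n -> ks_edge i x = p i))).
- by exists 0.
- by move=> A A' AA' [n hn]; exists n => x /AA'/hn.
- move=> A A' [n hn] [n' hn']; exists (maxn n n') => x [/hn h|/hn' h] xp;
    by apply: h => i hi; apply: xp; rewrite leq_max hi ?orbT.
- move=> x; have [i xi] : exists i, ks_edge i x <> p i.
    apply: contrapT => h; apply: no; exists x => i; apply: contrapT => hi.
    by apply: h; exists i.
  exists [set y | ks_edge i y = ks_edge i x]; first exact: ks_edge_lc.
  by exists i.+1 => y /= yx /(_ i (ltnSn i)); rewrite yx.
Qed.

(** A neighbourhood of a point contains all the points whose itinerary has the
    same beginning, up to some length. *)
Lemma ks_path_nbhs x (O : set X) : nbhs x O ->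
  exists n, forall y, (forall i, i < n -> ks_edge i y = ks_edge i x) -> O y.
Proof.
rewrite nbhsE => -[U [Uo Ux] UO].
suff [n hn] : exists n, forall y, [set: X] y ->
    (forall i, i < n -> ks_edge i y = ks_edge i x) -> U y.
  by exists n => y /(hn y I)/UO.
apply: (compact_ind cX (Q := fun A => exists n, forall y, A y ->
    (forall i, i < n -> ks_edge i y = ks_edge i x) -> U y)).
- by exists 0.
- by move=> A A' AA' [n hn]; exists n => y /AA'/hn.
- move=> A A' [n hn] [n' hn']; exists (maxn n n') => y [/hn h|/hn' h] xy;
    by apply: h => i hi; apply: xy; rewrite leq_max hi ?orbT.
- move=> z; have [Uz|nUz] := pselect (U z).
    by exists U; [exact: open_nbhs_nbhs|exists 0].
  have [i zi] : exists i, ks_edge i z <> ks_edge i x.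
    apply: contrapT => h; apply: nUz.
    suff -> : z = x by [].
    apply: ks_path_inj; apply: bpath_eq => i; apply: contrapT => hi.
    by apply: h; exists i.
  exists [set y | ks_edge i y = ks_edge i z]; first exact: ks_edge_lc.
  by exists i.+1 => y /= yz /(_ i (ltnSn i)); rewrite yz.
Qed.

(** [x] is on the last level of its tower in the [n]-th structure. *)
Definition ks_at_top n x : Prop := (klev (K n) x).+1 = kh (ktw (K n) x).

Lemma ks_not_top n x : ~ ks_at_top n x ->
  klev (K n) (phi x) = (klev (K n) x).+1 /\ ktw (K n) (phi x) = ktw (K n) x.
Proof.
move=> nt; apply: k_step; have := klev_lt (K n) x.
by rewrite leq_eqVlt => /predU1P[].
Qed.

Lemma ks_topP n x : ks_at_top n x <-> klev (K n) (phi x) = 0.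
Proof.
split=> [/k_top //|E]; apply: contrapT => /ks_not_top [].
by rewrite E.
Qed.

Lemma ks_topS n x : ks_at_top n.+1 x -> ks_at_top n x.
Proof. by move=> /ks_topP /(ks_ref K n).2 /ks_topP. Qed.

Lemma ks_top_le n m x : n <= m -> ks_at_top m x -> ks_at_top n x.
Proof.
elim: m => [|m IHm]; first by case: n.
by rewrite leq_eqVlt => /predU1P[-> //|nm /ks_topS]; apply: IHm.
Qed.

(** An edge is minimal when the passage is the first one in its tower, and
    maximal when it is the last one. *)
Lemma ks_edge_emin n x :
  emin (ks_edge n x) <-> klev (K n.+1) x = klev (K n) x.
Proof.
rewrite -ks_edge_pos; split=> [/(emin_kpos (ks_ref K n) equi phi_onto) -> //|E].
by apply/(emin_kpos (ks_ref K n) equi phi_onto); lia.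
Qed.

Lemma ks_edge_emax n x : emax (ks_edge n x) <->
  kh (ktw (K n.+1) x) + klev (K n) x = kh (ktw (K n) x) + klev (K n.+1) x.
Proof.
have := emax_kpos (ks_ref K n) equi phi_onto (ks_edge n x).
have -> : ksrc (ks_edge n x) = ktw (K n) x := ks_edge_src n x.
have -> : krng (ks_edge n x) = ktw (K n.+1) x := ks_edge_rng n x.
by move=> [h1 h2]; rewrite -ks_edge_pos; split=> [/h1|h]; [|apply: h2]; lia.
Qed.

Lemma ks_min_path x : min_path (ks_path x) <-> forall n, klev (K n) x = 0.
Proof.
split=> [mx|x0 n]; last by apply/ks_edge_emin; rewrite !x0.
by elim=> [|n IHn]; rewrite ?ks_lev0 // -IHn; apply/ks_edge_emin/mx.
Qed.

Lemma ks_max_path x : max_path (ks_path x) <-> forall n, ks_at_top n x.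
Proof.
split=> [mx|xt n].
  elim=> [|n IHn]; first by rewrite /ks_at_top ks_lev0 ks_kh0.
  by have /ks_edge_emax := mx n; rewrite /ks_at_top in IHn *; lia.
by apply/ks_edge_emax; have := xt n; have := xt n.+1; rewrite /ks_at_top; lia.
Qed.

(** The minimal path is the itinerary of the point to which the bases shrink, and
    the maximal path that of its preimage by [phi]. *)
Lemma ks_properly_ordered : properly_ordered ks_bratteli.
Proof.
case: hX => _ [_ [g [_ gK Kg]]] _; split.
  have top x : max_path (ks_path x) <-> phi x = ks_pt K.
    rewrite ks_max_path -ks_base; split=> h n; first exact/ks_topP.
    exact/ks_topP/h.
  exists (ks_path (g (ks_pt K))); split; first by apply/top; rewrite Kg.
  move=> p; have [x <-] := ks_path_surj p => /top <-.
  by rewrite gK.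
have min x : min_path (ks_path x) <-> x = ks_pt K by rewrite ks_min_path ks_base.
exists (ks_path (ks_pt K)); split; first exact/min.
by move=> p; have [x <-] := ks_path_surj p => /min <-.
Qed.

(** Up to the first structure in which [x] is not on a last level, [phi] brings
    [x] back to the bases; from there on it moves [x] up by one level without
    changing towers. *)
Lemma ks_path_step x : vershik_step (ks_path x) (ks_path (phi x)).
Proof.
have [top|ntop] := pselect (forall n, ks_at_top n x).
  left; split; first exact/ks_max_path.
  by apply/ks_min_path => n; apply/ks_topP.
have ex : exists n, `[< ~ ks_at_top n x >].
  by apply: contrapT => h; apply: ntop => n; apply: contrapT => hn;
    apply: h; exists n; apply/asboolP.
case: (ex_minnP ex) => -[|k] /asboolP nk kmin.
  by case: nk; rewrite /ks_at_top ks_lev0 ks_kh0.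
have top i : i <= k -> ks_at_top i x.
  by move=> ik; apply: contrapT => /asboolP/kmin; rewrite ltnNge ik.
have topE i : i <= k -> (klev (K i) x).+1 = kh (ktw (K i) x) by apply: top.
have top0 i : i <= k -> klev (K i) (phi x) = 0 by move=> /top/ks_topP.
have [E1 E2] := ks_not_top nk.
have lt := klev_lt (K k.+1) x.
have pos : kpos (ks_edge k (phi x)) = kpos (ks_edge k x) + kh (ksrc (ks_edge k x)).
  have -> : ksrc (ks_edge k x) = ktw (K k) x := ks_edge_src k x.
  rewrite -(topE k (leqnn k)).
  have := ks_edge_pos k x; have := ks_edge_pos k (phi x).
  by rewrite top0 // E1; lia.
have src0 : 0 < kh (ksrc (ks_edge k x)).
  have -> : ksrc (ks_edge k x) = ktw (K k) x := ks_edge_src k x.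
  by rewrite -(topE k (leqnn k)).
have rngE : krng (ks_edge k x) = krng (ks_edge k (phi x)).
  exact: etrans (ks_edge_rng k x) (etrans (esym E2) (esym (ks_edge_rng k (phi x)))).
have succ : esucc (ks_edge k x) (ks_edge k (phi x)).
  split=> [|e l]; first by rewrite kelt_pos rngE eqxx pos; lia.
  have := passage_gap (ks_ref K k) equi l; rewrite -pos => h.
  rewrite /= /kele h andbT -rngE.
  by move: l; rewrite kelt_pos => /andP[].
right; exists k; split.
- move=> i ik; apply/ks_edge_emax.
  by have := topE i (ltnW ik); have := topE i.+1 ik; lia.
- move=> /ks_edge_emax; have := topE k (leqnn k).
  by move: nk; rewrite /ks_at_top; lia.
- exact: succ.
- by move=> i ik; apply/ks_edge_emin; rewrite !top0 // ltnW.
- move=> i ki.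
  have nt j : k < j -> ~ ks_at_top j x.
    by move=> kj /(ks_top_le kj).
  have [E3 E4] := ks_not_top (nt _ ki); have [E5 E6] := ks_not_top (nt _ (leqW ki)).
  apply: kedge_eq; first by rewrite [LHS]ks_edge_rng [RHS]ks_edge_rng E6.
  have := ks_edge_pos i x; have := ks_edge_pos i (phi x).
  by rewrite E3 E5 /=; lia.
Qed.

Lemma ks_model : bratteli_vershik_model ks_bratteli phi.
Proof.
split; first exact: ks_properly_ordered.
pose a p := sval (cid (ks_path_surj p)).
have aK p : ks_path (a p) = p by rewrite /a; case: cid.
have Ka x : a (ks_path x) = x by apply: ks_path_inj; rewrite aK.
have ac : continuous a.
  move=> p O nO; have [n hn] := ks_path_nbhs nO.
  rewrite /nbhs /=; apply: filterS (nbhs_cylinder p n) => q qp; apply: hn => i ni.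
  have := qp i ni; rewrite -{1}(aK p) -{1}(aK q); exact.
exists a; split; last first.
  by split=> //; exists ks_path; split=> //; apply: ks_path_continuous.
split=> //.
  by apply/seteqP; split=> // x _; exists (ks_path x).
move=> p; apply: ks_path_inj; rewrite aK.
apply/esym/(vershikP _ _ ks_properly_ordered).
by rewrite -{1}(aK p); apply: ks_path_step.
Qed.

End Model.

(** * Refining sequences and the premorphism of a factor map *)

Section KRSeqExistence.
Variables (X : topologicalType) (phi : X -> X) (x0 : X).
Hypothesis hX : cantor_minimal_system phi.

(** The whole space as a single tower of height [1]. *)
Definition kr_trivial : kr phi.
Proof.
refine (@KR X phi unit (fun=> 1) (fun=> tt) (fun=> 0) (@lc_cst X unit tt)
  (@lc_cst X nat 0) _ _ _ _) => //.
by case; exists x0.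
Defined.

Variables (T : nat -> choiceType) (c : forall n, X -> T n).
Variable A : nat -> X -> bool.
Hypotheses (lc_c : forall n, loc_const (@c n)) (lc_A : forall n, loc_const (A n)).
Hypothesis Ax0 : forall n, A n x0.

(** A structure can be refined so that its base goes into [A n] and its levels
    determine [c n]. *)
Lemma kr_refine n (K : kr phi) : klev K x0 = 0 -> exists K' : kr phi,
  [/\ klev K' x0 = 0, refines (fun x => x) K K',
      forall x, klev K' x = 0 -> A n x &
      forall x x', ktw K' x = ktw K' x' -> klev K' x = klev K' x' ->
        c n x = c n x'].
Proof.
move=> K0; have [_ [_ [g [gc gK Kg]]] _] := hX.
pose U x := (klev K x == 0) && A n x.
have lU : loc_const U.
  apply: (lc_map (fun p : nat * bool => (p.1 == 0) && p.2)
    (f := fun x => (klev K x, A n x))).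
  exact: lc_pair (klev_lc K) (lc_A n).
have Ux0 : U x0 by rewrite /U K0 eqxx Ax0.
have lcc : loc_const (fun x => (ktw K x, klev K x, c n x)).
  by apply: lc_pair (lc_c n); apply: lc_pair (ktw_lc K) (klev_lc K).
have [K' [K'0 K'c]] := kr_exists hX gc gK Kg lU Ux0 lcc.
exists K'; split.
- by apply/eqP; rewrite K'0.
- split=> [x x' E1 E2|x /eqP]; first by have [-> ->] := K'c _ _ E1 E2.
  by rewrite K'0 => /andP[/eqP].
- by move=> x /eqP; rewrite K'0 => /andP[].
- by move=> x x' E1 E2; have [_ _ ->] := K'c _ _ E1 E2.
Qed.

Hypothesis c_sep : forall x y, (forall n, c n x = c n y) -> x = y.
Hypothesis A_pt : forall x, (forall n, A n x) -> x = x0.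

Lemma kr_seq_exists : exists K : kr_seq phi,
  [/\ ks_pt K = x0,
      forall n x, klev (K n.+1) x = 0 -> A n x &
      forall n x x', ktw (K n.+1) x = ktw (K n.+1) x' ->
        klev (K n.+1) x = klev (K n.+1) x' -> c n x = c n x'].
Proof.
pose st := {K : kr phi | klev K x0 = 0}.
pose next n (K : st) : st := let h := cid (kr_refine n (svalP K)) in
  exist (fun K : kr phi => klev K x0 = 0) (sval h) (let: And4 h0 _ _ _ := svalP h in h0).
pose s := fix s n : st := if n is n'.+1 then next n' (s n') else exist _ kr_trivial erefl.
have sS n : [/\ klev (sval (s n.+1)) x0 = 0,
    refines (fun x => x) (sval (s n)) (sval (s n.+1)),
    forall x, klev (sval (s n.+1)) x = 0 -> A n x &
    forall x x', ktw (sval (s n.+1)) x = ktw (sval (s n.+1)) x' ->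
      klev (sval (s n.+1)) x = klev (sval (s n.+1)) x' -> c n x = c n x'].
  exact: svalP (cid (kr_refine n (svalP (s n)))).
have card0 : #|kV (sval (s 0))| = 1 by rewrite /= card_unit.
have ref n : refines (fun x => x) (sval (s n)) (sval (s n.+1)) by have [] := sS n.
have base x : (forall n, klev (sval (s n)) x = 0) <-> x = x0.
  split=> [h|-> n]; last exact: svalP (s n).
  by apply: A_pt => n; have [_ _ h1 _] := sS n; apply/h1/h.
have sep x y : (forall n, ktw (sval (s n)) x = ktw (sval (s n)) y /\
    klev (sval (s n)) x = klev (sval (s n)) y) -> x = y.
  move=> h; apply: c_sep => n; have [_ _ _ h1] := sS n.
  by have [E1 E2] := h n.+1; apply: h1.
have kh0 (v : kV (sval (s 0))) : kh v = 1 by [].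
exists (@KRSeq X phi (fun n => sval (s n)) x0 card0 kh0 ref base sep).
by split=> // n; have [] := sS n.
Qed.

End KRSeqExistence.

Lemma cantor_coord_lc (X : topologicalType) (h : X -> cantor_space) n :
  continuous h -> loc_const (fun x => h x n : bool).
Proof.
move=> hc x.
have pc : continuous (fun x => proj n (h x) : bool).
  move=> z; apply: (@continuous_comp _ _ _ h (proj n)); first exact: hc.
  exact: proj_continuous.
have := pc x [set h x n]; apply.
rewrite nbhs_principalE.
by apply/principal_filterP.
Qed.

Section FactorPremorphism.
Variables (X Y : topologicalType) (phi : X -> X) (psi : Y -> Y) (alpha : X -> Y).
Hypotheses (hX : cantor_minimal_system phi) (hY : cantor_minimal_system psi).
Hypothesis fa : factor_map phi psi alpha.
Variables (KX : kr_seq phi) (KY : kr_seq psi).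
Hypothesis ref : forall n, refines alpha (KY n) (KX n).

Let equi x : alpha (phi x) = psi (alpha x).
Proof. by case: fa. Qed.

Let onto y : exists x, alpha x = y.
Proof.
case: fa => _ E _; have : range alpha y by rewrite E.
by case=> x _ <-; exists x.
Qed.

Local Notation C := (ks_bratteli KX hX).
Local Notation B := (ks_bratteli KY hY).

(** The edge sets of the premorphism, whose levels are [f n = n]. *)
Let F n : edgeset (bvert B n) (bvert C n) := kedges alpha (KY n) (KX n).

Lemma factor_comm n (h : n <= n.+1) :
  edgeset_iso (edgeset_comp (bedges B n) (F n.+1))
    (edgeset_comp (F n) (bsegment C h)).
Proof.
have pX := phi_onto hX; have pY := phi_onto hY.
apply: edgeset_iso_trans (iso_comp_r (F n) (bsegment_iso C h)).
apply: (@edgeset_iso_trans _ _ _ (kedges alpha (KY n) (KX n.+1))).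
  exact: (kedges_comp (ks_ref KY n) (ref n.+1) (fun y => erefl) equi pY pX).
apply: edgeset_iso_sym.
exact: (kedges_comp (ref n) (ks_ref KX n) equi (fun y => erefl) pX pX).
Qed.

(** A tower of height [1] contains a single passage. *)
Lemma factor_edges0 : #|F 0| = 1.
Proof.
apply/eqP/fintype1P; have x := ks_pt KX.
exists (edge_of (ref 0) equi (phi_onto hX) x) => e.
have pos0 (e' : F 0) : kpos e' = 0.
  have := passage_end (ref 0) equi e'; rewrite !ks_kh0; lia.
apply: kedge_eq; last by rewrite !pos0.
by have /fintype1P [u hu] := introT eqP (ks_card0 KX); rewrite (hu (krng _)) [RHS]hu.
Qed.

Definition factor_premorphism : premorphism B C.
Proof.
apply: (@Premorphism B C (fun n => n) F erefl (fun n => leqnSn n)).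
- by move=> N; exists N.
- move=> n; apply/card_gt0P.
  by exists (edge_of (ref n) equi (phi_onto hX) (ks_pt KX)).
- move=> n; exact: (kedges_src_surj (ref n) equi (phi_onto hX) onto).
- move=> n; exact: (kedges_rng_surj (ref n) equi (phi_onto hX)).
- exact: factor_edges0.
- by move=> n; apply: factor_comm.
Qed.

End FactorPremorphism.

Lemma factor_models (X Y : topologicalType) (phi : X -> X) (psi : Y -> Y)
    (alpha : X -> Y) :
  cantor_minimal_system phi -> cantor_minimal_system psi ->
  factor_map phi psi alpha ->
  exists C B : bratteli,
    [/\ bratteli_vershik_model C phi, bratteli_vershik_model B psi &
        inhabited (premorphism B C)].
Proof.
move=> hX hY fa; have [ac _ equi] := fa.
have [[hx [hxc [hx' [_ hxK hxK']]]] _ _] := hX.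
have [[hy [hyc [hy' [_ hyK _]]]] _ _] := hY.
pose x0 := hx' point; pose y0 := alpha x0.
have lx n : loc_const (fun x => hx x n : bool) := cantor_coord_lc n hxc.
have ly n : loc_const (fun y => hy y n : bool) := cantor_coord_lc n hyc.
have sepx x y : (forall n, hx x n = hx y n) -> x = y.
  by move=> h; apply: (can_inj hxK); apply: functional_extensionality_dep.
have sepy x y : (forall n, hy x n = hy y n) -> x = y.
  by move=> h; apply: (can_inj hyK); apply: functional_extensionality_dep.
have [KY [KYpt _ _]] : exists K : kr_seq psi,
  [/\ ks_pt K = y0,
      forall n y, klev (K n.+1) y = 0 -> hy y n == hy y0 n :> bool &
      forall n y y', ktw (K n.+1) y = ktw (K n.+1) y' ->
        klev (K n.+1) y = klev (K n.+1) y' -> hy y n = hy y' n :> bool].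
  apply: (@kr_seq_exists _ psi y0 hY (fun=> bool) (fun n y => hy y n : bool)
    (fun n y => hy y n == hy y0 n :> bool)) => //.
  - by move=> n; apply: (lc_map (fun b : bool => b == hy y0 n :> bool)).
  - by move=> y h; apply: sepy => n; apply/eqP.
(* The [n.+1]-st structure on [X] must be finer than the pull-back of the
   [n.+1]-st structure on [Y]; the trivial structures correspond at level 0. *)
pose P n := KY n.+1.
pose c n x := (hx x n : bool, ktw (P n) (alpha x), klev (P n) (alpha x)).
pose A n x := (hx x n == hx x0 n :> bool) && (klev (P n) (alpha x) == 0).
have lc n : loc_const (c n).
  apply: lc_pair; last exact: (lc_comp (f := klev (P n))) ac (klev_lc _).
  by apply: lc_pair; last exact: (lc_comp (f := ktw (P n))) ac (ktw_lc _).
have lA n : loc_const (A n).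
  apply: (lc_map (fun p => (p.1.1 == hx x0 n :> bool) && (p.2 == 0)) (lc n)).
have Ax0 n : A n x0.
  by rewrite /A eqxx /= (ks_base KY (alpha x0)).2.
have [KX [_ KXA KXc]] : exists K : kr_seq phi,
  [/\ ks_pt K = x0,
      forall n x, klev (K n.+1) x = 0 -> A n x &
      forall n x x', ktw (K n.+1) x = ktw (K n.+1) x' ->
        klev (K n.+1) x = klev (K n.+1) x' -> c n x = c n x'].
  apply: (@kr_seq_exists _ phi x0 hX
    (fun n => (bool * kV (P n) * nat)%type : choiceType) c A) => //.
  - by move=> x y h; apply: sepx => n; have [] := h n.
  - by move=> x h; apply: sepx => n; have /andP[/eqP] := h n.
have ref n : refines alpha (KY n) (KX n).
  case: n => [|n].
    split=> [x x' _ _|x _]; last exact: ks_lev0.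
    by split; [exact: ks_tw0|rewrite !ks_lev0].
  split=> [x x' E1 E2|x /KXA /andP[_ /eqP //]].
  by have [_ -> ->] := KXc _ _ _ E1 E2.
exists (ks_bratteli KX hX), (ks_bratteli KY hY); split; try exact: ks_model.
exact: inhabits (factor_premorphism hX hY fa ref).
Qed.

Theorem theorem4p7 (X Y : topologicalType) (phi : X -> X) (psi : Y -> Y)
    (hX : cantor_minimal_system phi) (hY : cantor_minimal_system psi) :
  (exists alpha : X -> Y, factor_map phi psi alpha) <->
  (exists C B : bratteli,
     [/\ bratteli_vershik_model C phi,
         bratteli_vershik_model B psi &
         inhabited (premorphism B C)]).
Proof.
split=> [[alpha fa]|[C [B [mC mB [pm]]]]]; first exact: factor_models fa.
exact: premorphism_factor mC mB pm.
Qed.
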